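(* Let $\mathfrak J_{\mathbb Z}$ be one of $\mathcal H_3(\mathbb B_{\mathbb Z}),\mathcal H_3(\mathbb H_{\mathbb Z}),\mathcal H_3(\mathbb O_{\mathbb Z})$ and let $\mathfrak M_{\mathbb Z}=\mathfrak M(\mathfrak J_{\mathbb Z})$. (1) Every element $x$ of rank $1$ in $\mathfrak M_{\mathbb Z}$ can be brought to the form $(\alpha,0,0,0)$ with $\alpha=d_1(x)$ by an element of the group $\mathrm{Inv}(\mathfrak M_{\mathbb Z})$. The set $\{(k,0,0,0)\mid k\in\mathbb Z,\ k\ge1\}$ is a complete set of distinct orbit representatives of elements of rank $1$ in $\mathfrak M_{\mathbb Z}$. (2) Every element $x$ of rank $2$ in $\mathfrak M_{\mathbb Z}$ can be brought to the form $(\alpha,0,\mathrm{diag}\{a,0,0\},0)$, where $\alpha\mid a$, $\alpha=d_1(x)$, $a=d_2(x)/(2\alpha)$, by an element of the group $\mathrm{Inv}(\mathfrak M_{\mathbb Z})$. The set $\{(k,0,\mathrm{diag}\{m,0,0\},0)\mid k,m\in\mathbb Z,\ k,m>0,\ k\mid m\}$ is a complete set of distinct orbit representatives of elements of rank $2$ in $\mathfrak M_{\mathbb Z}$. (3) In the case of rank $3$ or $4$, the group $\mathrm{Inv}(\mathfrak M_{\mathbb Z})$ acts transitively on the set of projective elements of norm $n$ (for every integer $n$). Every such element $x$ may be brought to the form $(1,\varepsilon,\mathrm{diag}\{1,1,k\},0)$ with $\varepsilon\in\{0,1\}$, $k\in\mathbb Z$, where $k=\frac{q'(x)-\varepsilon^2}{4}$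 and $\varepsilon\equiv q'(x)\pmod 2$ are uniquely determined by $x$.
   Context: Composition rings. $\mathbb H_{\mathbb Z}=M_2(\mathbb Z)$ with norm $\mathbf n=\det$, and conjugation $\overline{\begin{pmatrix}a&b\\c&d\end{pmatrix}}=\begin{pmatrix}d&-b\\-c&a\end{pmatrix}$; $\mathbb B_{\mathbb Z}\subset\mathbb H_{\mathbb Z}$ is the subring of diagonal matrices; $\mathbb O_{\mathbb Z}=\mathbb H_{\mathbb Z}\oplus\mathbb H_{\mathbb Z}v$ with product $(a+bv)(c+dv)=(ac-\bar d b)+(da+b\bar c)v$, norm $\mathbf n(a+bv)=\det a+\det b$, conjugation $\overline{a+bv}=\bar a-bv$. Put $\mathbf n(u,w)=\mathbf n(u+w)-\mathbf n(u)-\mathbf n(w)$. $\mathcal H_3(C_{\mathbb Z})$ is the $\mathbb Z$-module of Hermitian matrices $A=\begin{pmatrix}a&z&\bar y\\ \bar z&b&x\\ y&\bar x&c\end{pmatrix}$, $a,b,c\in\mathbb Z$, $x,y,z\in C_{\mathbb Z}$, with cubic norm $N(A)=abc-a\,x\bar x-b\,y\bar y-c\,z\bar z+(xy)z+\bar z(\bar y\bar x)$ and trace bilinear form $(A,A')=aa'+bb'+cc'+\mathbf n(x,x')+\mathbf n(y,y')+\mathbf n(z,z')$. The element with $x=y=z=0$ is written $\mathrm{diag}\{a,b,c\}$. The sharp map is defined by $(A^\#,B)=3N(A,A,B)$ for all $B$, where $N(\cdot,\cdot,\cdot)$ is the symmetric trilinear form (over $\mathbb Q$) with $N(A,A,A)=N(A)$.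 $\mathfrak M_{\mathbb Z}=\mathfrak M(\mathfrak J_{\mathbb Z})=\mathbb Z\oplus\mathbb Z\oplus\mathfrak J_{\mathbb Z}\oplus\mathfrak J_{\mathbb Z}$, with elements $x=(\alpha,\beta,A,B)$. For $y=(\gamma,\delta,C,D)$, $\{x,y\}=\alpha\delta-\beta\gamma+(A,D)-(B,C)$; $q(x)=8(A^\#,B^\#)-8\alpha N(A)-8\beta N(B)-2\bigl((A,B)-\alpha\beta\bigr)^2$, and $q'=-\tfrac12 q$; ''norm $n$'' means $q'(x)=n$. $\mathrm{Inv}(\mathfrak M_{\mathbb Z})$ is the group of invertible $\mathbb Z$-linear transformations of $\mathfrak M_{\mathbb Z}$ preserving $q$ and $\{\cdot,\cdot\}$. With $q(x,y,z,w)$ the symmetric four-linear form over $\mathbb Q$ satisfying $q(x,x,x,x)=q(x)$, $T(x,y,z)\in\mathfrak M_{\mathbb Z}\otimes\mathbb Q$ is defined by $\{T(x,y,z),w\}=q(x,y,z,w)$ for all $w$. The rank of $x$ is the integer between $0$ and $4$ determined by: rank $x=4$ iff $q(x)\ne0$; rank $x\le3$ iff $q(x)=0$; rank $x\le2$ iff $T(x,x,x)=0$; rank $x\le1$ iff $3T(x,x,y)+\{x,y\}x=0$ for all $y$; rank $x=0$ iff $x=0$. For a collection of elements of a free $\mathbb Z$-module, the gcd is the greatest integer $d$ dividing all of them ($d$ divides $m$ if $m=dm'$ with $m'$ in the module). $d_1(x)=\gcd(x)$ in $\mathfrak M_{\mathbb Z}$; $d_2(x)$ is the gcd in $\mathfrak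 M_{\mathbb Z}$ of all elements $3T(x,x,y)+\{x,y\}x$, $y\in\mathfrak M_{\mathbb Z}$ (these lie in $\mathfrak M_{\mathbb Z}$). Projective elements. An element $(\alpha,\beta,A,0)$ of $\mathfrak M_{\mathbb Z}$ is diagonal reduced if $\alpha>0$, $A=\mathrm{diag}\{a_1,a_2,a_3\}$, $\alpha\mid\beta$ and $\alpha\mid a_i$ for all $i$. Such an element is projective if $\gcd(\alpha a_1,\alpha\beta,a_2a_3)=\gcd(\alpha a_2,\alpha\beta,a_1a_3)=\gcd(\alpha a_3,\alpha\beta,a_1a_2)=1$. An arbitrary $x\in\mathfrak M_{\mathbb Z}$ is projective if its $\mathrm{Inv}(\mathfrak M_{\mathbb Z})$-orbit contains a diagonal reduced element that is projective. *)

(* Defs.v *)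
From HB Require Import structures.
From mathcomp Require Import all_boot all_order all_algebra.
From mathcomp Require Import boolp classical_sets.

Set Implicit Arguments.
Unset Strict Implicit.
Unset Printing Implicit Defensive.

Import Order.TTheory GRing.Theory Num.Theory.
Local Open Scope ring_scope.

(* Everything is built over an arbitrary base ring R and used for R = int and
   R = rat; the module over rat is the extension of scalars of the one over
   int, in which the polarized forms and their dual elements live. *)

Section SplitQuaternions.
Variable R : comNzRingType.

Definition mx2 (a b c d : R) : 'M[R]_2 :=
  \matrix_(i, j) if i == 0 then (if j == 0 then a else b)
                 else (if j == 0 then c else d).

Definition hconj (A : 'M[R]_2) : 'M[R]_2 :=
  mx2 (A 1 1) (- A 0 1) (- A 1 0) (A 0 0).

Definition diag2 : {pred 'M[R]_2} := fun A => is_diag_mx A.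

Fact diag2_subalg_closed : subalg_closed diag2.
Proof.
split=> [|a A B /is_diag_mxP dA /is_diag_mxP dB|A B /is_diag_mxP dA /is_diag_mxP dB].
- exact: scalar_mx_is_diag.
- by apply/is_diag_mxP => i j ij; rewrite !mxE dA // dB // mulr0 addr0.
apply/is_diag_mxP => i j ij; rewrite mxE big1 // => k _.
have [ik|ik] := eqVneq (i : nat) k; last by rewrite dA // mul0r.
by rewrite dB ?mulr0 // -ik.
Qed.

HB.instance Definition _ :=
  GRing.isSubalgClosed.Build R 'M[R]_2 diag2 diag2_subalg_closed.

Record diagmx2 := Diagmx2 { diagmx2_val :> 'M[R]_2; _ : diagmx2_val \in diag2 }.

HB.instance Definition _ := [isSub for diagmx2_val].
HB.instance Definition _ := [Choice of diagmx2 by <:].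
HB.instance Definition _ := [SubChoice_isSubNzRing of diagmx2 by <:].
HB.instance Definition _ := [SubZmodule_isSubLmodule of diagmx2 by <:].

Fact hconj_diag (A : diagmx2) : hconj A \in diag2.
Proof.
case: A => A /= /is_diag_mxP dA; apply/is_diag_mxP.
by case=> [[|[|//]] ?] [[|[|//]] ?] //= _; rewrite !mxE /= dA ?oppr0.
Qed.

Definition bconj (A : diagmx2) : diagmx2 := Diagmx2 (hconj_diag A).

(* The pair (a, b) stands for a + b v; the product is [omul], not the
   componentwise one of the product ring. *)
Definition octonion : Type := ('M[R]_2 * 'M[R]_2)%type.
HB.instance Definition _ := GRing.Lmodule.on octonion.

Definition omul (u w : octonion) : octonion :=
  let: (a, b) := u in let: (c, d) := w in
  (a *m c - hconj d *m b, d *m a + b *m hconj c).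

Definition oconj (u : octonion) : octonion := (hconj u.1, - u.2).

Definition onorm (u : octonion) : R := \det u.1 + \det u.2.

End SplitQuaternions.

(* [c_re] reads r off an element r *: c_one; it is only applied to such
   elements. *)
Record comp_ring (R : comNzRingType) := CompRing {
  c_sort :> lmodType R;
  c_one : c_sort;
  c_mul : c_sort -> c_sort -> c_sort;
  c_conj : c_sort -> c_sort;
  c_norm : c_sort -> R;
  c_re : c_sort -> R }.

Inductive comp_kind := CompB | CompH | CompO.

Definition comp_alg (k : comp_kind) (R : comNzRingType) : comp_ring R :=
  match k with
  | CompB => @CompRing R (diagmx2 R) 1 *%R (@bconj R)
               (fun A => \det (diagmx2_val A)) (fun A => diagmx2_val A 0 0)
  | CompH => @CompRing R 'M[R]_2 1%:M mulmx (@hconj R)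
               (fun A => \det A) (fun A => A 0 0)
  | CompO => @CompRing R (octonion R) (1%:M, 0) (@omul R) (@oconj R)
               (@onorm R) (fun u => u.1 0 0)
  end.

Fact map_diag (A : diagmx2 int) :
  map_mx intr (diagmx2_val A) \in diag2 (R := rat).
Proof.
case: A => A /= /is_diag_mxP dA; apply/is_diag_mxP => i j ij.
by rewrite mxE dA.
Qed.

Definition comp_toQ (k : comp_kind) : comp_alg k int -> comp_alg k rat :=
  match k return comp_alg k int -> comp_alg k rat with
  | CompB => fun A => Diagmx2 (map_diag A)
  | CompH => fun A => map_mx intr A
  | CompO => fun u => (map_mx intr u.1, map_mx intr u.2)
  end.

Section Hermitian.
Variables (R : comNzRingType) (C : comp_ring R).

Local Notation "u ** w" := (c_mul u w) (at level 40, left associativity).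
Local Notation cj := (@c_conj R C).

Definition c_bil (u w : C) : R := c_norm (u + w) - c_norm u - c_norm w.

(* (a, b, c, x, y, z) stands for the Hermitian matrix with rows
   (a, z, cj y), (cj z, b, x), (y, cj x, c), where cj is conjugation in C. *)
Definition herm3 : Type := (R^o * R^o * R^o * C * C * C)%type.
HB.instance Definition _ := GRing.Lmodule.on herm3.

Definition diag3 (a b c : R) : herm3 := (a, b, c, 0, 0, 0).

Definition cubicC (A : herm3) : C :=
  let: (a, b, c, x, y, z) := A in
  (a * b * c) *: c_one C - a *: (x ** cj x) - b *: (y ** cj y)
    - c *: (z ** cj z) + ((x ** y) ** z + cj z ** (cj y ** cj x)).

Definition cubic (A : herm3) : R := c_re (cubicC A).

Definition jtrace (A A' : herm3) : R :=
  let: (a, b, c, x, y, z) := A in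
  let: (a', b', c', x', y', z') := A' in
  a * a' + b * b' + c * c' + c_bil x x' + c_bil y y' + c_bil z z'.

Definition freudenthal : Type := (R^o * R^o * herm3 * herm3)%type.
HB.instance Definition _ := GRing.Lmodule.on freudenthal.

Definition melt (al be : R) (A B : herm3) : freudenthal := (al, be, A, B).

Definition symp (x y : freudenthal) : R :=
  let: (al, be, A, B) := x in
  let: (ga, de, C, D) := y in
  al * de - be * ga + jtrace A D - jtrace B C.

End Hermitian.

(* The symmetric n-linear form whose diagonal is f, when f is a form of
   degree n (polarization identity). *)
Definition polar (V : zmodType) (n : nat) (f : V -> rat) (v : n.-tuple V) : rat :=
  (n`!%:R)^-1 *
  \sum_(S : {set 'I_n}) (-1) ^+ (n - #|S|)%N * f (\sum_(i in S) tnth v i).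

Section Rational.
Variable k : comp_kind.
Local Notation J := (herm3 (comp_alg k rat)).
Local Notation M := (freudenthal (comp_alg k rat)).

Definition cubic3 (A B C : J) : rat :=
  polar (@cubic _ (comp_alg k rat)) [tuple A; B; C].

(* [xget 0 P] is the element of P, and 0 if P is empty.  Here and in [triple]
   the element exists and is unique: the trace form and the symplectic form are
   nondegenerate. *)
Definition sharp (A : J) : J :=
  xget 0 [set S : J | forall B : J, jtrace S B = 3 * cubic3 A A B]%classic.

Definition quartic (x : M) : rat :=
  let: (al, be, A, B) := x in
  8 * jtrace (sharp A) (sharp B) - 8 * al * cubic A - 8 * be * cubic B
    - 2 * (jtrace A B - al * be) ^+ 2.

Definition quartic4 (x y z w : M) : rat := polar quartic [tuple x; y; z; w].

Definition triple (x y z : M) : M :=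
  xget 0 [set t : M | forall w : M, symp t w = quartic4 x y z w]%classic.

Definition rank1_op (x y : M) : M := 3 *: triple x x y + symp x y *: x.

End Rational.

Definition herm3_toQ (k : comp_kind) (A : herm3 (comp_alg k int)) :
    herm3 (comp_alg k rat) :=
  let: (a, b, c, x, y, z) := A in
  (a%:~R, b%:~R, c%:~R, comp_toQ x, comp_toQ y, comp_toQ z).

Definition toQ (k : comp_kind) (x : freudenthal (comp_alg k int)) :
    freudenthal (comp_alg k rat) :=
  let: (al, be, A, B) := x in (al%:~R, be%:~R, herm3_toQ A, herm3_toQ B).

Section Integral.
Variable k : comp_kind.
Local Notation MZ := (freudenthal (comp_alg k int)).
Local Notation MQ := (freudenthal (comp_alg k rat)).

Definition qZ (x : MZ) : rat := quartic (toQ x).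

Definition q'Z (x : MZ) : rat := - (1 / 2) * qZ x.

Definition is_Inv (g : {linear MZ -> MZ}) : Prop :=
  [/\ bijective g,
      forall x, qZ (g x) = qZ x
    & forall x y, symp (g x) (g y) = symp x y].

Definition same_orbit (x y : MZ) : Prop :=
  exists g : {linear MZ -> MZ}, is_Inv g /\ g x = y.

Definition has_rank (x : MZ) (r : nat) : Prop :=
  (r <= 4)%N /\
  [/\ r = 4%N <-> qZ x <> 0,
      (r <= 3)%N <-> qZ x = 0,
      (r <= 2)%N <-> triple (toQ x) (toQ x) (toQ x) = 0,
      (r <= 1)%N <-> (forall y : MZ, rank1_op (toQ x) (toQ y) = 0)
    & r = 0%N <-> x = 0].

(* Divisibility in the lattice MZ, for elements given in MQ. *)
Definition divides (d : int) (m : MQ) : Prop :=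
  exists m' : MZ, m = toQ (d *: m').

Definition is_gcd (S : set MQ) (d : int) : Prop :=
  (forall m, S m -> divides d m) /\
  (forall e : int, (forall m, S m -> divides e m) -> e <= d).

Definition is_d1 (x : MZ) (d : int) : Prop :=
  is_gcd [set toQ x]%classic d.

Definition is_d2 (x : MZ) (d : int) : Prop :=
  is_gcd [set rank1_op (toQ x) (toQ y) | y in [set: MZ]]%classic d.

Definition mdiag (al be a1 a2 a3 : int) : MZ :=
  melt al be (diag3 (comp_alg k int) a1 a2 a3) 0.

Definition diag_reduced (al be a1 a2 a3 : int) : bool :=
  [&& 0 < al, (al %| be)%Z, (al %| a1)%Z, (al %| a2)%Z & (al %| a3)%Z].

Definition gcd3 (a b c : int) : int := gcdz (gcdz a b) c.

Definition reduced_projective (al be a1 a2 a3 : int) : bool :=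
  [&& gcd3 (al * a1) (al * be) (a2 * a3) == 1,
      gcd3 (al * a2) (al * be) (a1 * a3) == 1
    & gcd3 (al * a3) (al * be) (a1 * a2) == 1].

Definition projective (x : MZ) : Prop :=
  exists al be a1 a2 a3 : int,
    [/\ same_orbit x (mdiag al be a1 a2 a3),
        diag_reduced al be a1 a2 a3
      & reduced_projective al be a1 a2 a3].

Definition orbit_representatives (P S : set MZ) : Prop :=
  [/\ forall s, S s -> P s,
      forall x, P x -> exists s, S s /\ same_orbit x s
    & forall s t, S s -> S t -> same_orbit s t -> s = t].

End Integral.

(* Main.v *)
Require Import Defs.
From HB Require Import structures.
From mathcomp Require Import all_boot all_order all_algebra.
From mathcomp Require Import boolp classical_sets.
From mathcomp Require Import ring zify.
Import Order.TTheory GRing.Theory Num.Theory.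
Set Implicit Arguments.
Unset Strict Implicit.
Unset Printing Implicit Defensive.
Local Open Scope ring_scope.

(** On each of the three composition rings, x ** y = conj (x y) is the product
    of a symmetric composition algebra: n(x ** y) = n(x) n(y) and
    n(x ** y, z) = n(x, y ** z). In terms of it
    N(A) = abc - a n(x) - b n(y) - c n(z) + n(x ** y, z), and all the identities
    for the cubic and quartic forms follow from these two laws. So the three
    cases are treated at once, the octonions included; besides the laws only
    the fact that the norm form is split and unimodular over the integers is
    used ([comp_alg_laws]).

    The group Inv is used through a few elements: the exchange of the two halves
    of the space, the cyclic permutation of the diagonal, the elementary maps
    A |-> g A g^* together with their contragredients, and one family of
    exponentials ([quart_psi]). Since the trace and symplectic forms are
    unimodular, T(x, x, y) is determined by the numbers q(x, x, y, w) with w in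
    the lattice; hence rank, d_1 and d_2 are invariants of orbits, and for the
    elements (al, be, A, 0) they are given by short formulas
    ([quartic4_reduced], [rank1_form_reduced]).

    Every nonzero x is in the orbit of some (al, be, A, 0) with al > 0 dividing
    be and A: take the smallest positive first coordinate in the orbit, for
    otherwise a division step would produce a smaller one ([reduction]). In rank
    at most 2 the vanishing of T forces be = 0 and A^# = 0. In rank 1 it also
    follows that A = 0. In rank 2 the same minimality argument inside the Jordan
    algebra brings A to diag(a, 0, 0) ([rank_two_diag]). The values
    d_1 = al and d_2 = 2 al a separate the orbits.

    For a projective diagonal reduced element, al = 1. Translations replace
    (a1, be, - a2 a3), seen as a binary quadratic form, by an equivalent form,
    and elementary maps replace two diagonal entries by their gcd and, up to
    sign, their lcm. Projectivity lets these moves alternate until two diagonal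
    entries are 1 ([dia_projective]); a last translation reduces be modulo 2.
    What is left, (1, eps, diag(1, 1, m), 0), has norm 4m + eps^2, which
    determines eps and m. *)

(** * Symmetric composition algebras *)

Section CompositionLaws.
Variables (R : comNzRingType) (C : comp_ring R).

Definition para (x y : C) : C := c_conj (c_mul x y).

(** With the product [para] and the form [c_norm], C is a symmetric
    composition algebra, and N takes a form that is visibly invariant under
    cyclic permutation of x, y, z. The list [hyp] pairs each vector of an
    isotropic basis with its dual vector: it says that the norm form is split
    and unimodular. *)
Record composition_laws (hyp : seq (C * C)) : Prop := CompositionLaws {
  paraDl : forall x x' y, para (x + x') y = para x y + para x' y;
  paraDr : forall x y y', para x (y + y') = para x y + para x y';
  paraZl : forall r x y, para (r *: x) y = r *: para x y;
  paraZr : forall r x y, para x (r *: y) = r *: para x y;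
  normZ : forall (r : R) (x : C), c_norm (r *: x) = r ^+ 2 * c_norm x;
  bilDl : forall x x' y : C, c_bil (x + x') y = c_bil x y + c_bil x' y;
  bilZl : forall r (x y : C), c_bil (r *: x) y = r * c_bil x y;
  norm_para : forall x y : C, c_norm (para x y) = c_norm x * c_norm y;
  bil_para : forall x y z : C, c_bil (para x y) z = c_bil x (para y z);
  cubicE : forall a b c (x y z : C),
    @cubic R C (a, b, c, x, y, z) =
    a * b * c - a * c_norm x - b * c_norm y - c * c_norm z
      + c_bil (para x y) z;
  hyp_isotropic : forall p, p \in hyp ->
    [/\ c_norm p.1 = 0, c_norm p.2 = 0 & c_bil p.1 p.2 = 1];
  hyp_dual : forall x : C, x = \sum_(p <- hyp) c_bil x p.2 *: p.1;
  hyp_neq0 : hyp != [::] }.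

End CompositionLaws.

Section Coordinates.
Variable R : comNzRingType.
Implicit Types a b c d r : R.

Lemma mx2_eta (A : 'M[R]_2) : A = mx2 (A 0 0) (A 0 1) (A 1 0) (A 1 1).
Proof.
by apply/matrixP => -[[|[|//]] ?] [[|[|//]] ?]; rewrite !mxE /=;
  congr (A _ _); apply/val_inj.
Qed.

Lemma mx2_00 a b c d : mx2 a b c d 0 0 = a. Proof. by rewrite mxE. Qed.
Lemma mx2_01 a b c d : mx2 a b c d 0 1 = b. Proof. by rewrite mxE. Qed.
Lemma mx2_10 a b c d : mx2 a b c d 1 0 = c. Proof. by rewrite mxE. Qed.
Lemma mx2_11 a b c d : mx2 a b c d 1 1 = d. Proof. by rewrite mxE. Qed.

Lemma mx2D a b c d a' b' c' d' :
  mx2 a b c d + mx2 a' b' c' d' = mx2 (a + a') (b + b') (c + c') (d + d').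
Proof. by rewrite [LHS]mx2_eta !mxE. Qed.

Lemma mx2N a b c d : - mx2 a b c d = mx2 (- a) (- b) (- c) (- d).
Proof. by rewrite [LHS]mx2_eta !mxE. Qed.

Lemma mx2Z r a b c d : r *: mx2 a b c d = mx2 (r * a) (r * b) (r * c) (r * d).
Proof. by rewrite [LHS]mx2_eta !mxE. Qed.

Lemma mx2M a b c d a' b' c' d' :
  mx2 a b c d *m mx2 a' b' c' d' =
  mx2 (a * a' + b * c') (a * b' + b * d') (c * a' + d * c') (c * b' + d * d').
Proof.
by rewrite [LHS]mx2_eta !mxE !big_ord_recl !big_ord0 !mxE /= !addr0.
Qed.

Lemma mx2_conj a b c d : hconj (mx2 a b c d) = mx2 d (- b) (- c) a.
Proof. by rewrite /hconj !mxE. Qed.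

Lemma mx2_det a b c d : \det (mx2 a b c d) = a * d - b * c.
Proof.
rewrite (expand_det_row _ 0) !big_ord_recl big_ord0 /cofactor !det_mx11 !mxE /=.
by ring.
Qed.

Lemma mx2_0 : 0 = mx2 0 0 0 0 :> 'M[R]_2.
Proof. by rewrite [LHS]mx2_eta !mxE. Qed.

Lemma mx2_1 : 1%:M = mx2 1 0 0 1 :> 'M[R]_2.
Proof. by rewrite [LHS]mx2_eta !mxE. Qed.

Definition mx2E := (mx2_0, mx2_1, mx2M, mx2_conj, mx2D, mx2N, mx2Z, mx2_det,
  mx2_00, mx2_01, mx2_10, mx2_11).

End Coordinates.

Lemma mx2P (R : comNzRingType) (P : 'M[R]_2 -> Prop) :
  (forall a b c d, P (mx2 a b c d)) -> forall A, P A.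
Proof. by move=> H A; rewrite (mx2_eta A). Qed.

Section Laws.
Variable R : comNzRingType.

Definition hyp_basisH : seq ('M[R]_2 * 'M[R]_2) :=
  [:: (mx2 1 0 0 0, mx2 0 0 0 1); (mx2 0 0 0 1, mx2 1 0 0 0);
      (mx2 0 1 0 0, mx2 0 0 (-1) 0); (mx2 0 0 1 0, mx2 0 (-1) 0 0)].

Lemma quaternion_laws : @composition_laws R (comp_alg CompH R) hyp_basisH.
Proof.
split; rewrite /para /c_bil /=.
- by do 3 elim/mx2P=> ????; rewrite !mx2E; congr mx2; ring.
- by do 3 elim/mx2P=> ????; rewrite !mx2E; congr mx2; ring.
- by move=> ?; do 2 elim/mx2P=> ????; rewrite !mx2E; congr mx2; ring.
- by move=> ?; do 2 elim/mx2P=> ????; rewrite !mx2E; congr mx2; ring.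
- by move=> ?; do 1 elim/mx2P=> ????; rewrite !mx2E; ring.
- by do 3 elim/mx2P=> ????; rewrite !mx2E; ring.
- by move=> ?; do 2 elim/mx2P=> ????; rewrite !mx2E; ring.
- by do 2 elim/mx2P=> ????; rewrite !mx2E; ring.
- by do 3 elim/mx2P=> ????; rewrite !mx2E; ring.
- move=> a b c; do 3 elim/mx2P=> ????; rewrite /cubic /= !mx2E /=; ring.
- by move=> p; rewrite !inE => /or4P[] /eqP->; rewrite /= !mx2E; split; ring.
- by elim/mx2P=> ????; rewrite !big_cons big_nil /= !mx2E; congr mx2; ring.
by [].
Qed.

Lemma octonionP (P : octonion R -> Prop) :
  (forall a b c d a' b' c' d', P (mx2 a b c d, mx2 a' b' c' d')) ->
  forall u, P u.
Proof. by move=> H [A B]; rewrite (mx2_eta A) (mx2_eta B). Qed.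

Lemma octD (a b c d : 'M[R]_2) :
  (a, b) + (c, d) = (a + c, b + d) :> octonion R.
Proof. by []. Qed.

Lemma octZ r (a b : 'M[R]_2) : r *: ((a, b) : octonion R) = (r *: a, r *: b).
Proof. by []. Qed.

Lemma octN (a b : 'M[R]_2) : - ((a, b) : octonion R) = (- a, - b).
Proof. by []. Qed.

Lemma oct_conjE (a b : 'M[R]_2) : oconj (a, b) = (hconj a, - b).
Proof. by []. Qed.

Lemma omulE (a b c d : 'M[R]_2) : omul (a, b) (c, d) =
  (a *m c - hconj d *m b, d *m a + b *m hconj c).
Proof. by []. Qed.

Lemma onormE (a b : 'M[R]_2) : onorm (a, b) = \det a + \det b.
Proof. by []. Qed.

Definition octE := (octD, octZ, octN, omulE, oct_conjE, onormE).

Definition hyp_basisO : seq (octonion R * octonion R) :=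
  [seq ((p.1, 0), (p.2, 0)) | p <- hyp_basisH] ++
  [seq ((0, p.1), (0, p.2)) | p <- hyp_basisH].

Lemma octonion_laws : @composition_laws R (comp_alg CompO R) hyp_basisO.
Proof.
split; rewrite /para /c_bil /=.
- do 3 elim/octonionP=> ????????; rewrite !(octE, mx2E).
  by congr (mx2 _ _ _ _, mx2 _ _ _ _); ring.
- do 3 elim/octonionP=> ????????; rewrite !(octE, mx2E).
  by congr (mx2 _ _ _ _, mx2 _ _ _ _); ring.
- move=> ?; do 2 elim/octonionP=> ????????; rewrite !(octE, mx2E).
  by congr (mx2 _ _ _ _, mx2 _ _ _ _); ring.
- move=> ?; do 2 elim/octonionP=> ????????; rewrite !(octE, mx2E).
  by congr (mx2 _ _ _ _, mx2 _ _ _ _); ring.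
- by move=> ?; do 1 elim/octonionP=> ????????; rewrite !(octE, mx2E); ring.
- by do 3 elim/octonionP=> ????????; rewrite !(octE, mx2E); ring.
- by move=> ?; do 2 elim/octonionP=> ????????; rewrite !(octE, mx2E); ring.
- by do 2 elim/octonionP=> ????????; rewrite !(octE, mx2E); ring.
- by do 3 elim/octonionP=> ????????; rewrite !(octE, mx2E); ring.
- move=> a b c; do 3 elim/octonionP=> ????????.
  by rewrite /cubic /= !(octE, mx2E) /= ?mx2E; ring.
- move=> p; rewrite !inE; do ![case/orP]; move/eqP->;
   by rewrite /= !(octE, mx2E); split; ring.
- elim/octonionP=> ????????; rewrite !big_cons big_nil /= addr0 !(octE, mx2E).
  by congr (mx2 _ _ _ _, mx2 _ _ _ _); ring.
by [].
Qed.

End Laws.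

Section DiagonalLaws.
Variable R : comNzRingType.

Fact diag_mx2 (a d : R) : mx2 a 0 0 d \in diag2 (R := R).
Proof. by apply/is_diag_mxP => -[[|[|//]] ?] [[|[|//]] ?] //=; rewrite mxE. Qed.

Definition dmx2 a d : diagmx2 R := Diagmx2 (diag_mx2 a d).

Lemma dmx2P (P : diagmx2 R -> Prop) :
  (forall a d, P (dmx2 a d)) -> forall A, P A.
Proof.
move=> H A; have -> // : A = dmx2 (diagmx2_val A 0 0) (diagmx2_val A 1 1).
apply: val_inj; rewrite /= [LHS]mx2_eta.
by case: A => A /= /is_diag_mxP dA; rewrite (dA 0 1) // (dA 1 0).
Qed.

Lemma dmx2D a d a' d' : dmx2 a d + dmx2 a' d' = dmx2 (a + a') (d + d').
Proof. by apply: val_inj; rewrite /= mx2D addr0. Qed.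

Lemma dmx2N a d : - dmx2 a d = dmx2 (- a) (- d).
Proof. by apply: val_inj; rewrite /= mx2N oppr0. Qed.

Lemma dmx2Z r a d : r *: dmx2 a d = dmx2 (r * a) (r * d).
Proof. by apply: val_inj; rewrite /= mx2Z mulr0. Qed.

Lemma mx2_mul a b c d a' b' c' d' : mx2 a b c d * mx2 a' b' c' d' =
  mx2 (a * a' + b * c') (a * b' + b * d') (c * a' + d * c') (c * b' + d * d')
  :> 'M[R]_2.
Proof. exact: mx2M. Qed.

Lemma mx2_one : 1 = mx2 1 0 0 1 :> 'M[R]_2.
Proof. exact: mx2_1. Qed.

Lemma dmx2M a d a' d' : dmx2 a d * dmx2 a' d' = dmx2 (a * a') (d * d').
Proof.
by apply: val_inj; rewrite /= -[X in X = _]/(_ *m _) mx2M; congr mx2; ring.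
Qed.

Lemma dmx2_1 : 1 = dmx2 1 1.
Proof. by apply: val_inj; rewrite /= -[X in X = _]/(1%:M) mx2_1. Qed.

Lemma dmx2_conj a d : bconj (dmx2 a d) = dmx2 d a.
Proof. by apply: val_inj; rewrite /= mx2_conj oppr0. Qed.

Lemma dmx2_det a d : \det (diagmx2_val (dmx2 a d)) = a * d.
Proof. by rewrite mx2_det mulr0 subr0. Qed.

Definition dmx2E :=
  (dmx2_1, dmx2M, dmx2_conj, dmx2D, dmx2N, dmx2Z, dmx2_det).

Definition hyp_basisB : seq (diagmx2 R * diagmx2 R) :=
  [:: (dmx2 1 0, dmx2 0 1); (dmx2 0 1, dmx2 1 0)].

Lemma diagonal_laws : @composition_laws R (comp_alg CompB R) hyp_basisB.
Proof.
split; rewrite /para /c_bil /=.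
- by do 3 elim/dmx2P=> ??; rewrite !dmx2E; congr dmx2; ring.
- by do 3 elim/dmx2P=> ??; rewrite !dmx2E; congr dmx2; ring.
- by move=> ?; do 2 elim/dmx2P=> ??; rewrite !dmx2E; congr dmx2; ring.
- by move=> ?; do 2 elim/dmx2P=> ??; rewrite !dmx2E; congr dmx2; ring.
- by move=> ?; do 1 elim/dmx2P=> ??; rewrite /= !mx2E; ring.
- by do 3 elim/dmx2P=> ??; rewrite /= !mx2E; ring.
- by move=> ?; do 2 elim/dmx2P=> ??; rewrite /= !mx2E; ring.
- by do 2 elim/dmx2P=> ??; rewrite /= !(mx2_mul, mx2E); ring.
- by do 3 elim/dmx2P=> ??; rewrite /= !(mx2_mul, mx2E); ring.
- move=> a b c; do 3 elim/dmx2P=> ??.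
  by rewrite /cubic /= !(mx2_mul, mx2_one, mx2E) /=; ring.
- by move=> p; rewrite !inE => /orP[] /eqP->; rewrite /= !mx2E; split; ring.
- elim/dmx2P=> ??; rewrite !big_cons big_nil /= addr0 !mx2E !dmx2E.
  by congr dmx2; ring.
by [].
Qed.
End DiagonalLaws.

Definition hyp_basis (k : comp_kind) R : seq (comp_alg k R * comp_alg k R) :=
  match k with
  | CompB => hyp_basisB R | CompH => hyp_basisH R | CompO => hyp_basisO R
  end.

Lemma comp_alg_laws (k : comp_kind) R : composition_laws (hyp_basis k R).
Proof.
case: k; [exact: diagonal_laws|exact: quaternion_laws|exact: octonion_laws].
Qed.

(** * Extension of scalars *)

Section ToQ.
Variable k : comp_kind.
Local Notation Z := (comp_alg k int).

Lemma map_mx2 (a b c d : int) : map_mx intr (mx2 a b c d) =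
  mx2 a%:~R b%:~R c%:~R d%:~R :> 'M[rat]_2.
Proof. by rewrite [LHS]mx2_eta !mxE. Qed.

Lemma comp_toQ_D (x y : Z) : comp_toQ (x + y) = comp_toQ x + comp_toQ y.
Proof.
case: k x y => /= [x y||].
- by apply: val_inj; rewrite /= map_mxD.
- exact: map_mxD.
by case=> a b [c d]; rewrite octD /= !map_mxD.
Qed.

Lemma comp_toQ_norm (x : Z) : c_norm (comp_toQ x) = (c_norm x)%:~R.
Proof.
case: k x => /= [||[x y]] *; rewrite ?det_map_mx // /onorm /= !det_map_mx.
by rewrite rmorphD.
Qed.

Lemma comp_toQ_bil (x y : Z) :
  c_bil (comp_toQ x) (comp_toQ y) = (c_bil x y)%:~R.
Proof. by rewrite /c_bil -comp_toQ_D !comp_toQ_norm !rmorphB. Qed.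

Lemma comp_toQ_para (x y : Z) :
  comp_toQ (para x y) = para (comp_toQ x) (comp_toQ y).
Proof.
rewrite /para; case: k x y => /=.
- do 2 elim/dmx2P=> ??; apply: val_inj; rewrite /= !(mx2_mul, mx2E, map_mx2) /=.
  by congr mx2; ring.
- by do 2 elim/mx2P=> ????; rewrite !(mx2E, map_mx2); congr mx2; ring.
do 2 elim/octonionP=> ????????; rewrite !(octE, mx2E) /= !(octE,mx2E, map_mx2).
by congr (mx2 _ _ _ _, mx2 _ _ _ _); ring.
Qed.

Lemma hyp_basis_toQ : hyp_basis k rat =
  [seq (comp_toQ p.1, comp_toQ p.2) | p <- hyp_basis k int].
Proof.
case: k => /=.
- by congr [:: (_, _); (_, _)]; apply: val_inj; rewrite /= map_mx2.
- by rewrite !map_mx2.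
by rewrite !map_mx2 !map_mx0.
Qed.
End ToQ.

(** * The cubic Jordan algebra and its norm-preserving maps *)

Lemma eq_by_diff (V : zmodType) (x y a b : V) : a = b -> x - y = a - b -> x = y.
Proof. by move=> -> /eqP; rewrite subrr subr_eq0 => /eqP. Qed.

Section Jordan.
Variables (R : comNzRingType) (C : comp_ring R) (hyp : seq (C * C)).
Hypothesis laws : composition_laws hyp.
Implicit Types (r s t : R) (u v w x y z : C) (A B : herm3 C).
Local Notation n := (@c_norm R C).
Local Notation bil := (@c_bil R C).
Local Notation "x ** y" := (para x y) (at level 40, left associativity).

Lemma bilC x y : bil x y = bil y x.
Proof. by rewrite /c_bil (addrC x); ring. Qed.

Lemma bilDr x y z : bil x (y + z) = bil x y + bil x z.
Proof. by rewrite bilC (bilDl laws) !(bilC x). Qed.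

Lemma bilZr r x y : bil x (r *: y) = r * bil x y.
Proof. by rewrite bilC (bilZl laws) (bilC x). Qed.

Lemma bilNl x y : bil (- x) y = - bil x y.
Proof. by rewrite -scaleN1r (bilZl laws) mulN1r. Qed.

Lemma bilNr x y : bil x (- y) = - bil x y.
Proof. by rewrite bilC bilNl bilC. Qed.

Lemma bil0l x : bil 0 x = 0.
Proof. by rewrite -[0](scale0r 0) (bilZl laws) mul0r. Qed.

Lemma bil0r x : bil x 0 = 0.
Proof. by rewrite bilC bil0l. Qed.

Lemma normD x y : n (x + y) = n x + n y + bil x y.
Proof. by rewrite /c_bil; ring. Qed.

Lemma normN x : n (- x) = n x.
Proof. by rewrite -scaleN1r (normZ laws) sqrrN expr1n mul1r. Qed.

Lemma norm0 : n 0 = 0.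
Proof. by rewrite -[0](scale0r 0) (normZ laws) expr0n mul0r. Qed.

Lemma bilxx x : bil x x = 2 * n x.
Proof.
rewrite /c_bil -mulr2n -scaler_nat (normZ laws) -natrX.
by ring.
Qed.

Lemma paraNl x y : (- x) ** y = - (x ** y).
Proof. by rewrite -scaleN1r (paraZl laws) scaleN1r. Qed.

Lemma paraNr x y : x ** (- y) = - (x ** y).
Proof. by rewrite -scaleN1r (paraZr laws) scaleN1r. Qed.

Lemma para0l y : 0 ** y = 0.
Proof. by rewrite -[X in X ** _](scale0r 0) (paraZl laws) scale0r. Qed.

Lemma para0r x : x ** 0 = 0.
Proof. by rewrite -[X in _ ** X](scale0r 0) (paraZr laws) scale0r. Qed.

Definition linE := (bilDl laws, bilDr, bilZl laws, bilZr, bilNl, bilNr, bil0l,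
  bil0r, paraDl laws, paraDr laws, paraZl laws, paraZr laws, paraNl, paraNr,
  para0l, para0r, normD, normN, normZ laws, norm0).

Lemma bil_inj x y : (forall w, bil x w = bil y w) -> x = y.
Proof.
move=> xy; rewrite (hyp_dual laws x) (hyp_dual laws y).
by apply: eq_bigr => p _; rewrite xy.
Qed.

(** Polarization in y of n(x ** y) = n(x) n(y). *)
Lemma bil_paral x y z : bil (x ** y) (x ** z) = n x * bil y z.
Proof.
have := norm_para laws x (y + z); rewrite !linE !(norm_para laws).
by move/eq_by_diff; apply; ring.
Qed.

Lemma bil_parar x y z : bil (y ** x) (z ** x) = n x * bil y z.
Proof.
have := norm_para laws (y + z) x; rewrite !linE !(norm_para laws).
by move/eq_by_diff; apply; ring.
Qed.

Lemma bil_cyc x y z : bil (x ** y) z = bil (y ** z) x.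
Proof. by rewrite (bil_para laws) bilC. Qed.

(** Together with [para_sandwichr] this replaces the alternative law: pair
    both sides with an arbitrary vector and use that multiplication by x is a
    similitude of factor n(x). *)
Lemma para_sandwichl x y : (x ** y) ** x = n x *: y.
Proof.
by apply: bil_inj => w; rewrite (bil_para laws) bil_paral (bilZl laws).
Qed.

Lemma para_sandwichr x y : x ** (y ** x) = n x *: y.
Proof.
apply: bil_inj => w; rewrite bilC -(bil_para laws) bil_parar.
by rewrite (bilZl laws) (bilC w).
Qed.

Lemma para_flexl x y z : (x ** y) ** z + (z ** y) ** x = bil x z *: y.
Proof.
apply: bil_inj => w.
have := congr1 (bil^~ w) (para_sandwichl (x + z) y).
rewrite !linE !para_sandwichl !linE.
by move/eq_by_diff; apply; ring.
Qed.

Lemma para_flexr x y z : x ** (y ** z) + z ** (y ** x) = bil x z *: y.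
Proof.
apply: bil_inj => w.
have := congr1 (bil^~ w) (para_sandwichr (x + z) y).
rewrite !linE !para_sandwichr !linE.
by move/eq_by_diff; apply; ring.
Qed.

Fact herm_key : unit. Proof. by []. Qed.

(** Locked, since a sum of tuples is itself convertible to a tuple: without
    the lock, rules stated on coordinates would apply to such sums and expose
    projections. *)
Definition herm (a b c : R) x y z : herm3 C :=
  locked_with herm_key ((a, b, c, x, y, z) : herm3 C).

Lemma herm_tuple a b c x y z : herm a b c x y z = (a, b, c, x, y, z).
Proof. exact: unlock. Qed.

Lemma hermP (P : herm3 C -> Prop) :
  (forall a b c x y z, P (herm a b c x y z)) -> forall A, P A.
Proof.
by move=> H [[[[[a b] c] x] y] z]; have := H a b c x y z; rewrite herm_tuple.
Qed.

Lemma herm_inj a b c x y z a' b' c' x' y' z' :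
  herm a b c x y z = herm a' b' c' x' y' z' ->
  [/\ a = a', b = b', c = c' & [/\ x = x', y = y' & z = z']].
Proof. by rewrite !herm_tuple => -[]. Qed.

Lemma hermD a b c x y z a' b' c' x' y' z' :
  herm a b c x y z + herm a' b' c' x' y' z' =
  herm (a + a') (b + b') (c + c') (x + x') (y + y') (z + z').
Proof. by rewrite !herm_tuple. Qed.

Lemma hermZ r a b c x y z : r *: herm a b c x y z =
  herm (r * a) (r * b) (r * c) (r *: x) (r *: y) (r *: z).
Proof. by rewrite !herm_tuple. Qed.

Lemma hermN a b c x y z : - herm a b c x y z =
  herm (- a) (- b) (- c) (- x) (- y) (- z).
Proof. by rewrite !herm_tuple. Qed.

Lemma herm0 : 0 = herm 0 0 0 0 0 0.
Proof. by rewrite !herm_tuple. Qed.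

Lemma cubic_herm a b c x y z : cubic (herm a b c x y z) =
  a * b * c - a * n x - b * n y - c * n z + bil (x ** y) z.
Proof. by rewrite herm_tuple (cubicE laws). Qed.

Lemma jtraceE a b c x y z a' b' c' x' y' z' :
  jtrace (herm a b c x y z) (herm a' b' c' x' y' z') =
  a * a' + b * b' + c * c' + bil x x' + bil y y' + bil z z'.
Proof. by rewrite !herm_tuple. Qed.

Definition jsharp (A : herm3 C) : herm3 C :=
  let: (a, b, c, x, y, z) := A in
  herm (b * c - n x) (a * c - n y) (a * b - n z)
       (y ** z - a *: x) (z ** x - b *: y) (x ** y - c *: z).

Lemma jsharpE a b c x y z : jsharp (herm a b c x y z) =
  herm (b * c - n x) (a * c - n y) (a * b - n z)
       (y ** z - a *: x) (z ** x - b *: y) (x ** y - c *: z).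
Proof. by rewrite {1}herm_tuple. Qed.

Definition jcyc (A : herm3 C) : herm3 C :=
  let: (a, b, c, x, y, z) := A in herm b c a y z x.

Lemma jcycE a b c x y z : jcyc (herm a b c x y z) = herm b c a y z x.
Proof. by rewrite {1}herm_tuple. Qed.

(** The map A |-> g A g^* for the elementary matrix g with entry u in position
    (1, 2). The matrix product makes sense only when C is associative; the
    formula stays meaningful for octonions. *)
Definition elem12 u (A : herm3 C) : herm3 C :=
  let: (a, b, c, x, y, z) := A in
  herm (a + bil z u + b * n u) b c x (y + u ** x) (z + b *: u).

(** The same for the entry in position (2, 1). Since [elem21 (- u)] is the
    contragredient of [elem12 u] for the trace form, the two act together on
    the last two components of the quartic space. *)
Definition elem21 u (A : herm3 C) : herm3 C :=
  let: (a, b, c, x, y, z) := A in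
  herm a (b + bil z u + a * n u) c (x + y ** u) y (z + a *: u).

Lemma elem12E u a b c x y z : elem12 u (herm a b c x y z) =
  herm (a + bil z u + b * n u) b c x (y + u ** x) (z + b *: u).
Proof. by rewrite {1}herm_tuple. Qed.

Lemma elem21E u a b c x y z : elem21 u (herm a b c x y z) =
  herm a (b + bil z u + a * n u) c (x + y ** u) y (z + a *: u).
Proof. by rewrite {1}herm_tuple. Qed.

Definition hermE := (hermZ, hermN, hermD).
Definition hE := (elem12E, elem21E, jcycE, jsharpE).

Lemma jtraceC A B : jtrace A B = jtrace B A.
Proof.
elim/hermP: A => a b c x y z; elim/hermP: B => a' b' c' x' y' z'.
rewrite !jtraceE (bilC x) (bilC y) (bilC z).
by ring.
Qed.

Lemma jtraceDl A A' B : jtrace (A + A') B = jtrace A B + jtrace A' B.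
Proof.
elim/hermP: A => a b c x y z; elim/hermP: A' => a' b' c' x' y' z'.
elim/hermP: B => *; rewrite hermD !jtraceE !linE.
by ring.
Qed.

Lemma jtraceZl r A B : jtrace (r *: A) B = r * jtrace A B.
Proof.
elim/hermP: A => a b c x y z; elim/hermP: B => *.
rewrite hermZ !jtraceE !linE.
by ring.
Qed.

Lemma jtraceDr A B B' : jtrace A (B + B') = jtrace A B + jtrace A B'.
Proof. by rewrite jtraceC jtraceDl !(jtraceC A). Qed.

Lemma jtraceZr r A B : jtrace A (r *: B) = r * jtrace A B.
Proof. by rewrite jtraceC jtraceZl (jtraceC A). Qed.

Lemma jtrace0l B : jtrace 0 B = 0.
Proof. by rewrite -[0](scale0r 0) jtraceZl mul0r. Qed.

Lemma jtrace0r A : jtrace A 0 = 0.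
Proof. by rewrite jtraceC jtrace0l. Qed.

Lemma jtraceNl A B : jtrace (- A) B = - jtrace A B.
Proof. by rewrite -scaleN1r jtraceZl mulN1r. Qed.

Lemma jtraceNr A B : jtrace A (- B) = - jtrace A B.
Proof. by rewrite jtraceC jtraceNl jtraceC. Qed.

Lemma jtrace_inj A A' : (forall B, jtrace A B = jtrace A' B) -> A = A'.
Proof.
elim/hermP: A => a b c x y z; elim/hermP: A' => a' b' c' x' y' z' H.
congr herm.
- by have := H (herm 1 0 0 0 0 0); rewrite !jtraceE !linE !(mulr1,mulr0,addr0).
- by have := H (herm 0 1 0 0 0 0);
    rewrite !jtraceE !linE !(mulr1,mulr0,addr0,add0r).
- by have := H (herm 0 0 1 0 0 0);
    rewrite !jtraceE !linE !(mulr1,mulr0,addr0,add0r).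
- by apply: bil_inj => w; have := H (herm 0 0 0 w 0 0);
    rewrite !jtraceE !linE !(mulr1,mulr0,addr0,add0r).
- by apply: bil_inj => w; have := H (herm 0 0 0 0 w 0);
    rewrite !jtraceE !linE !(mulr1,mulr0,addr0,add0r).
by apply: bil_inj => w; have := H (herm 0 0 0 0 0 w);
  rewrite !jtraceE !linE !(mulr1,mulr0,addr0,add0r).
Qed.

Lemma elem12_linear u : linear (elem12 u).
Proof.
move=> r A B; elim/hermP: A => a b c x y z; elim/hermP: B => a' b' c' x' y' z'.
rewrite !(hermE, hE) !linE; congr herm; first by ring.
- by rewrite scalerDr addrACA.
by rewrite scalerDr scalerDl scalerA addrACA.
Qed.

Lemma elem21_linear u : linear (elem21 u).
Proof.
move=> r A B; elim/hermP: A => a b c x y z; elim/hermP: B => a' b' c' x' y' z'.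
rewrite !(hermE, hE) !linE; congr herm; first by ring.
- by rewrite scalerDr addrACA.
by rewrite scalerDr scalerDl scalerA addrACA.
Qed.

Lemma jcyc_linear : linear jcyc.
Proof.
by move=> r A B; elim/hermP: A => *; elim/hermP: B => *; rewrite !(hermE, hE).
Qed.

Lemma elem12K u : cancel (elem12 u) (elem12 (- u)).
Proof.
elim/hermP=> a b c x y z; rewrite !hE !linE; congr herm; rewrite ?addrK //.
  by rewrite bilxx; ring.
by rewrite scalerN addrK.
Qed.

Lemma elem21K u : cancel (elem21 u) (elem21 (- u)).
Proof.
elim/hermP=> a b c x y z; rewrite !hE !linE; congr herm; rewrite ?addrK //.
  by rewrite bilxx; ring.
by rewrite scalerN addrK.
Qed.

Lemma jcycK A : jcyc (jcyc (jcyc A)) = A.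
Proof. by elim/hermP: A => *; rewrite !jcycE. Qed.

(** All terms linear in u cancel by the cyclic invariance of n(x ** y, z), the
    quadratic ones by the sandwich law. *)
Lemma cubic_elem12 u A : cubic (elem12 u A) = cubic A.
Proof.
elim/hermP: A => a b c x y z.
rewrite elem12E !cubic_herm !linE !(norm_para laws) para_sandwichr !linE.
rewrite [bil y (u ** x)]bilC [bil (u ** x) y]bil_cyc (bilC u z).
by rewrite bilxx; ring.
Qed.

Lemma cubic_elem21 u A : cubic (elem21 u A) = cubic A.
Proof.
elim/hermP: A => a b c x y z.
rewrite elem21E !cubic_herm !linE !(norm_para laws) para_sandwichl !linE.
rewrite -(bil_para laws) (bilC u z) bilxx.
by ring.
Qed.

Lemma cubic_jcyc A : cubic (jcyc A) = cubic A.
Proof.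
elim/hermP: A => a b c x y z.
by rewrite jcycE !cubic_herm -bil_cyc; ring.
Qed.

Lemma jtrace_elem12 u A B : jtrace (elem12 u A) (elem21 (- u) B) = jtrace A B.
Proof.
elim/hermP: A => a b c x y z; elim/hermP: B => a' b' c' x' y' z'.
rewrite !hE !jtraceE !linE (bilC x (y' ** u)) (bil_cyc u x y').
rewrite (bil_cyc x y' u) (bilC u) bilxx.
by ring.
Qed.

Lemma jtrace_jcyc A B : jtrace (jcyc A) (jcyc B) = jtrace A B.
Proof.
elim/hermP: A => *; elim/hermP: B => *; rewrite !hE !jtraceE.
by ring.
Qed.

(** The sharp map is the gradient of an invariant form, so it carries a map to
    its contragredient. *)
Lemma jsharp_elem12 u A : jsharp (elem12 u A) = elem21 (- u) (jsharp A).
Proof.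
elim/hermP: A => a b c x y z; rewrite !hE !linE !(norm_para laws).
congr herm.
- by rewrite (bilC y) (bil_cyc u); ring.
- by ring.
- apply: bil_inj => w; rewrite !linE -addrA.
  have := congr1 (bil^~ w) (para_flexl u x z).
  rewrite !linE (bilC u z) para_sandwichl !linE => H.
  by apply: (eq_by_diff H); ring.
- by rewrite scalerDr -!scaleNr; apply: bil_inj => w; rewrite !linE; ring.
by rewrite para_sandwichr; apply: bil_inj => w; rewrite !linE; ring.
Qed.

Lemma jsharp_elem21 u A : jsharp (elem21 u A) = elem12 (- u) (jsharp A).
Proof.
elim/hermP: A => a b c x y z; rewrite !hE !linE !(norm_para laws).
congr herm.
- by rewrite -(bil_para laws); ring.
- by ring.
- by apply: bil_inj => w; rewrite !linE; ring.
- apply: bil_inj => w; rewrite !linE -addrA.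
  have := congr1 (bil^~ w) (para_flexr z y u).
  rewrite !linE (para_sandwichr u) linE => H.
  by apply: (eq_by_diff H); ring.
by rewrite para_sandwichl; apply: bil_inj => w; rewrite !linE; ring.
Qed.

Lemma jsharp_jcyc A : jsharp (jcyc A) = jcyc (jsharp A).
Proof.
elim/hermP: A => *; rewrite !hE; congr herm; ring.
Qed.

(** The sharp map is the gradient of the cubic form. *)
Lemma cubicD A B : cubic (A + B) =
  cubic A + jtrace (jsharp A) B + jtrace A (jsharp B) + cubic B.
Proof.
elim/hermP: A => a b c x y z; elim/hermP: B => a' b' c' x' y' z'.
rewrite !(hermE, hE) !cubic_herm !jtraceE !linE.
rewrite -!(bil_para laws) -(bil_cyc x' y z) (bil_cyc z x y').
rewrite -(bil_cyc x' y z') (bil_cyc z x' y').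
by ring.
Qed.

(** The linearization of the sharp map. *)
Definition jcross A B : herm3 C :=
  let: (a, b, c, x, y, z) := A in
  let: (a', b', c', x', y', z') := B in
  herm (b * c' + b' * c - bil x x') (a * c' + a' * c - bil y y')
       (a * b' + a' * b - bil z z')
       (y ** z' + y' ** z - a *: x' - a' *: x)
       (z ** x' + z' ** x - b *: y' - b' *: y)
       (x ** y' + x' ** y - c *: z' - c' *: z).

Lemma jcrossE a b c x y z a' b' c' x' y' z' :
  jcross (herm a b c x y z) (herm a' b' c' x' y' z') =
  herm (b * c' + b' * c - bil x x') (a * c' + a' * c - bil y y')
       (a * b' + a' * b - bil z z')
       (y ** z' + y' ** z - a *: x' - a' *: x)
       (z ** x' + z' ** x - b *: y' - b' *: y)
       (x ** y' + x' ** y - c *: z' - c' *: z).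
Proof. by rewrite ![in LHS]herm_tuple. Qed.

Lemma jsharpD A B : jsharp (A + B) = jsharp A + jsharp B + jcross A B.
Proof.
elim/hermP: A => a b c x y z; elim/hermP: B => a' b' c' x' y' z'.
rewrite !(hermE, hE, jcrossE) !linE; congr herm; try by ring.
- by apply: bil_inj => w; rewrite !linE; ring.
- by apply: bil_inj => w; rewrite !linE; ring.
by apply: bil_inj => w; rewrite !linE; ring.
Qed.

Lemma jcrossC A B : jcross A B = jcross B A.
Proof.
elim/hermP: A => a b c x y z; elim/hermP: B => a' b' c' x' y' z'.
rewrite !jcrossE (bilC x) (bilC y) (bilC z).
congr herm; try by ring.
- by apply: bil_inj => w; rewrite !linE; ring.
- by apply: bil_inj => w; rewrite !linE; ring.
by apply: bil_inj => w; rewrite !linE; ring.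
Qed.

Lemma jcrossDl A A' B : jcross (A + A') B = jcross A B + jcross A' B.
Proof.
elim/hermP: A => a b c x y z; elim/hermP: A' => a' b' c' x' y' z'.
elim/hermP: B => a2 b2 c2 x2 y2 z2.
rewrite !(hermE, jcrossE) !linE; congr herm; try by ring.
- by apply: bil_inj => w; rewrite !linE; ring.
- by apply: bil_inj => w; rewrite !linE; ring.
by apply: bil_inj => w; rewrite !linE; ring.
Qed.

Lemma jcrossZl r A B : jcross (r *: A) B = r *: jcross A B.
Proof.
elim/hermP: A => a b c x y z; elim/hermP: B => a2 b2 c2 x2 y2 z2.
rewrite !(hermE, jcrossE) !linE; congr herm; try by ring.
- by apply: bil_inj => w; rewrite !linE; ring.
- by apply: bil_inj => w; rewrite !linE; ring.
by apply: bil_inj => w; rewrite !linE; ring.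
Qed.

Lemma jsharpZ r A : jsharp (r *: A) = r ^+ 2 *: jsharp A.
Proof.
elim/hermP: A => a b c x y z.
rewrite !(hermE, hE) !linE; congr herm; try by ring.
- by apply: bil_inj => w; rewrite !linE; ring.
- by apply: bil_inj => w; rewrite !linE; ring.
by apply: bil_inj => w; rewrite !linE; ring.
Qed.

Lemma jtrace_cross_cyc A B D :
  jtrace (jcross A B) D = jtrace (jcross B D) A.
Proof.
elim/hermP: A => a b c x y z; elim/hermP: B => a' b' c' x' y' z'.
elim/hermP: D => a2 b2 c2 x2 y2 z2.
rewrite !jcrossE !jtraceE !linE.
rewrite -(bil_cyc x2 y z') -(bil_cyc x2 y' z) (bil_cyc z x' y2).
rewrite (bil_cyc z' x y2) -(bil_cyc x y' z2) -(bil_cyc x y2 z').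
rewrite (bil_cyc z' x2 y) (bil_cyc z2 x' y) (bilC x2 x) (bilC y2 y) (bilC z2 z).
rewrite (bilC x' x) (bilC y' y) (bilC z' z).
by ring.
Qed.

Lemma cubicZ r A : cubic (r *: A) = r ^+ 3 * cubic A.
Proof.
elim/hermP: A => a b c x y z; rewrite hermE !cubic_herm !linE.
by ring.
Qed.

Lemma jtrace_sharp A : jtrace (jsharp A) A = 3 * cubic A.
Proof.
elim/hermP: A => a b c x y z; rewrite hE jtraceE cubic_herm !linE !bilxx.
rewrite -(bil_cyc x y z) (bil_cyc z x y).
by ring.
Qed.

Lemma jcrossxx A : jcross A A = 2 *: jsharp A.
Proof.
apply: jtrace_inj => B.
have := congr1 (@jtrace _ C ^~ B) (jsharpD A A).
have -> : A + A = 2 *: A by rewrite scaler_nat mulr2n.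
rewrite jsharpZ !jtraceDl !jtraceZl.
by move/esym/eq_by_diff; apply; ring.
Qed.

Lemma jcrossDr A B B' : jcross A (B + B') = jcross A B + jcross A B'.
Proof. by rewrite jcrossC jcrossDl !(jcrossC A). Qed.

Lemma jcross0l A : jcross 0 A = 0.
Proof. by rewrite -[X in jcross X _](scale0r 0) jcrossZl scale0r. Qed.

Lemma jcross0r A : jcross A 0 = 0.
Proof. by rewrite jcrossC jcross0l. Qed.

Lemma cubic0 : @cubic R C 0 = 0.
Proof. by rewrite -[X in cubic X](scale0r 0) cubicZ expr0n mul0r. Qed.

Lemma jsharp0 : jsharp (0 : herm3 C) = 0.
Proof. by rewrite -[X in jsharp X](scale0r 0) jsharpZ expr0n scale0r. Qed.


End Jordan.

(** * The quartic form and its symmetries *)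

Section Freudenthal.
Variables (R : comNzRingType) (C : comp_ring R) (hyp : seq (C * C)).
Hypothesis laws : composition_laws hyp.
Implicit Types (r s t : R) (u : C) (A B : herm3 C).
Local Notation n := (@c_norm R C).
Local Notation bil := (@c_bil R C).
Local Notation "x ** y" := (para x y) (at level 40, left associativity).
Local Notation linE := (linE laws).

Fact frd_key : unit. Proof. by []. Qed.

(** Locked for the same reason as [herm]. *)
Definition frd (al be : R) A B : freudenthal C :=
  locked_with frd_key (melt al be A B).

Lemma frd_melt al be A B : frd al be A B = melt al be A B.
Proof. exact: unlock. Qed.

Lemma frdP (P : freudenthal C -> Prop) :
  (forall al be A B, P (frd al be A B)) -> forall x, P x.
Proof.
by move=> H [[[al be] A] B]; have := H al be A B; rewrite frd_melt.
Qed.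

Lemma frd_inj al be A B al' be' A' B' : frd al be A B = frd al' be' A' B' ->
  [/\ al = al', be = be', A = A' & B = B'].
Proof. by rewrite !frd_melt => -[]. Qed.

Lemma frdD al be A B al' be' A' B' : frd al be A B + frd al' be' A' B' =
  frd (al + al') (be + be') (A + A') (B + B').
Proof. by rewrite !frd_melt. Qed.

Lemma frdZ r al be A B : r *: frd al be A B =
  frd (r * al) (r * be) (r *: A) (r *: B).
Proof. by rewrite !frd_melt. Qed.

Lemma frdN al be A B : - frd al be A B = frd (- al) (- be) (- A) (- B).
Proof. by rewrite !frd_melt. Qed.

Lemma frd0 : 0 = frd 0 0 0 0.
Proof. by rewrite !frd_melt. Qed.

Definition frdE := (frdZ, frdN, frdD).

Lemma sympE al be A B al' be' A' B' :
  symp (frd al be A B) (frd al' be' A' B') =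
  al * be' - be * al' + jtrace A B' - jtrace B A'.
Proof. by rewrite !frd_melt. Qed.

(** The quartic form, with [jsharp] in place of the sharp map defined by
    duality; it has integral values and makes sense over every ring. *)
Definition quart (x : freudenthal C) : R := let: (al, be, A, B) := x in
  8 * jtrace (jsharp A) (jsharp B) - 8 * al * cubic A - 8 * be * cubic B
    - 2 * (jtrace A B - al * be) ^+ 2.

Lemma quartE al be A B : quart (frd al be A B) =
  8 * jtrace (jsharp A) (jsharp B) - 8 * al * cubic A - 8 * be * cubic B
    - 2 * (jtrace A B - al * be) ^+ 2.
Proof. by rewrite !frd_melt. Qed.

Definition is_symmetry (f : freudenthal C -> freudenthal C) : Prop :=
  [/\ linear f, bijective f, forall x, quart (f x) = quart x
    & forall x y, symp (f x) (f y) = symp x y].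

(** The Weyl element exchanging the two halves of the space. *)
Definition frdJ (x : freudenthal C) : freudenthal C :=
  let: (al, be, A, B) := x in frd (- be) al (- B) A.

Lemma frdJE al be A B : frdJ (frd al be A B) = frd (- be) al (- B) A.
Proof. by rewrite {1}frd_melt. Qed.

Definition frd_cyc (x : freudenthal C) : freudenthal C :=
  let: (al, be, A, B) := x in frd al be (jcyc A) (jcyc B).

Lemma frd_cycE al be A B :
  frd_cyc (frd al be A B) = frd al be (jcyc A) (jcyc B).
Proof. by rewrite {1}frd_melt. Qed.

Definition frd12 u (x : freudenthal C) : freudenthal C :=
  let: (al, be, A, B) := x in frd al be (elem12 u A) (elem21 (- u) B).

Lemma frd12E u al be A B :
  frd12 u (frd al be A B) = frd al be (elem12 u A) (elem21 (- u) B).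
Proof. by rewrite {1}frd_melt. Qed.

Definition frd21 u (x : freudenthal C) : freudenthal C :=
  let: (al, be, A, B) := x in frd al be (elem21 u A) (elem12 (- u) B).

Lemma frd21E u al be A B :
  frd21 u (frd al be A B) = frd al be (elem21 u A) (elem12 (- u) B).
Proof. by rewrite {1}frd_melt. Qed.

(** With e = diag(1,0,0), this is the exponential of the nilpotent map sending
    (al, be, A, B) to t (0, (A, e), B x e, al e). *)
Definition frd_psi t (x : freudenthal C) : freudenthal C :=
  let: (al, be, (a1, a2, a3, x, y, z), (b1, b2, b3, x', y', z')) := x in
  frd al (be + t * a1)
    (@herm R C a1 (a2 + t * b3) (a3 + t * b2) (x - t *: x') y z)
    (@herm R C (b1 + t * al) b2 b3 x' y' z').

Lemma frd_psiE t al be a1 a2 a3 x y z b1 b2 b3 x' y' z' :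
  frd_psi t (frd al be (herm a1 a2 a3 x y z) (herm b1 b2 b3 x' y' z')) =
  frd al (be + t * a1)
    (@herm R C a1 (a2 + t * b3) (a3 + t * b2) (x - t *: x') y z)
    (herm (b1 + t * al) b2 b3 x' y' z').
Proof. by rewrite {1}frd_melt ![in LHS]herm_tuple. Qed.

Lemma symmetryN : is_symmetry -%R.
Proof.
split.
- by move=> r x y; rewrite opprD scalerN.
- by exists -%R => x; rewrite opprK.
- elim/frdP=> al be A B; rewrite frdN !quartE -!scaleN1r !(jsharpZ laws).
  rewrite !(cubicZ laws) !(jtraceZl laws) !(jtraceZr laws).
  by ring.
elim/frdP=> al be A B; elim/frdP=> al' be' A' B'.
rewrite !frdN !sympE !(jtraceNl laws) !(jtraceNr laws).
by ring.
Qed.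

Lemma symmetryJ : is_symmetry frdJ.
Proof.
split.
- move=> r; elim/frdP=> al be A B; elim/frdP=> al' be' A' B'.
  by rewrite !(frdE, frdJE) !(opprD, scalerN) mulrN.
- exists (fun x => - frdJ x); elim/frdP=> al be A B;
    by rewrite !(frdJE, frdN) !opprK.
- elim/frdP=> al be A B; rewrite frdJE !quartE -!scaleN1r !(jsharpZ laws).
  rewrite !(cubicZ laws) !(jtraceZl laws) (jtraceC B) (jtraceC (jsharp B)).
  by ring.
elim/frdP=> al be A B; elim/frdP=> al' be' A' B'.
rewrite !frdJE !sympE !(jtraceNl laws) !(jtraceNr laws) (jtraceC A) (jtraceC B).
by rewrite (jtraceC B'); ring.
Qed.

Lemma symmetry_cyc : is_symmetry frd_cyc.
Proof.
split.
- move=> r; elim/frdP=> al be A B; elim/frdP=> al' be' A' B'.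
  by rewrite !(frdE, frd_cycE) !(jcyc_linear (C := C)).
- exists (frd_cyc \o frd_cyc); elim/frdP=> al be A B;
    by rewrite /= !frd_cycE !jcycK.
- elim/frdP=> al be A B; rewrite frd_cycE !quartE !jsharp_jcyc.
  by rewrite !jtrace_jcyc !(cubic_jcyc laws).
elim/frdP=> al be A B; elim/frdP=> al' be' A' B'.
by rewrite !frd_cycE !sympE !jtrace_jcyc.
Qed.

Lemma jtrace_elem21 u A B : jtrace (elem21 u A) (elem12 (- u) B) = jtrace A B.
Proof.
by rewrite jtraceC -{2}(opprK u) (jtrace_elem12 laws) jtraceC.
Qed.

Lemma symmetry12 u : is_symmetry (frd12 u).
Proof.
split.
- move=> r; elim/frdP=> al be A B; elim/frdP=> al' be' A' B'.
  by rewrite !(frdE, frd12E) !(elem12_linear laws) !(elem21_linear laws).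
- exists (frd12 (- u)); elim/frdP=> al be A B;
    rewrite /= !frd12E ?(elem12K laws) ?(elem21K laws) //.
  by rewrite -{1}(opprK u) -{3}(opprK u) (elem12K laws) (elem21K laws).
- elim/frdP=> al be A B; rewrite frd12E !quartE.
  rewrite (jsharp_elem12 laws) (jsharp_elem21 laws).
  rewrite jtrace_elem21 !(jtrace_elem12 laws) (cubic_elem12 laws).
  by rewrite (cubic_elem21 laws).
elim/frdP=> al be A B; elim/frdP=> al' be' A' B'.
rewrite !frd12E !sympE !(jtrace_elem12 laws) !(jtraceC (elem21 _ _)).
by rewrite (jtrace_elem12 laws) (jtraceC A').
Qed.

Lemma symmetry21 u : is_symmetry (frd21 u).
Proof.
split.
- move=> r; elim/frdP=> al be A B; elim/frdP=> al' be' A' B'.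
  by rewrite !(frdE, frd21E) !(elem12_linear laws) !(elem21_linear laws).
- exists (frd21 (- u)); elim/frdP=> al be A B;
    rewrite /= !frd21E ?(elem12K laws) ?(elem21K laws) //.
  by rewrite -{1}(opprK u) -{3}(opprK u) (elem12K laws) (elem21K laws).
- elim/frdP=> al be A B; rewrite frd21E !quartE.
  rewrite (jsharp_elem21 laws) (jsharp_elem12 laws).
  rewrite jtrace_elem21 !(jtrace_elem12 laws) (cubic_elem12 laws).
  by rewrite (cubic_elem21 laws).
elim/frdP=> al be A B; elim/frdP=> al' be' A' B'.
rewrite !frd21E !sympE !jtrace_elem21 !(jtraceC (elem12 _ _)).
by rewrite jtrace_elem21 (jtraceC A').
Qed.

Lemma frdhP (P : freudenthal C -> Prop) :
  (forall al be a1 a2 a3 x y z b1 b2 b3 x' y' z',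
    P (frd al be (herm a1 a2 a3 x y z) (herm b1 b2 b3 x' y' z'))) ->
  forall x, P x.
Proof.
move=> H; elim/frdP=> al be A B.
by elim/hermP: A => *; elim/hermP: B => *; exact: H.
Qed.

Lemma frd_psi_linear t : linear (frd_psi t).
Proof.
move=> r; elim/frdhP=> al be a1 a2 a3 x y z b1 b2 b3 x' y' z'.
elim/frdhP=> *; rewrite !(frdE, hermE) !frd_psiE !(frdE, hermE).
congr frd; [by ring|congr herm; try by ring|congr herm; by ring].
by apply: (bil_inj laws) => w; rewrite !linE; ring.
Qed.

Lemma frd_psiK t : cancel (frd_psi t) (frd_psi (- t)).
Proof.
elim/frdhP=> al be a1 a2 a3 x y z b1 b2 b3 x' y' z'; rewrite !frd_psiE.
by congr frd; [ring|congr herm; rewrite ?scaleNr ?opprK ?subrK //; ring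
  |congr herm; ring].
Qed.

(** The trilinear values n(x ** y, z) occur in several cyclic forms; once they
    are brought to one of them the identity is polynomial in the remaining
    values of the norm form. *)
Lemma quart_psi t x : quart (frd_psi t x) = quart x.
Proof.
elim/frdhP: x => al be a1 a2 a3 x y z b1 b2 b3 x' y' z'.
rewrite frd_psiE !quartE !jsharpE !(cubic_herm laws) !jtraceE !linE.
rewrite !(bil_parar laws) !(bil_paral laws) !(bilxx laws).
rewrite -!(bil_para laws) -(bil_cyc laws x' y z) -(bil_cyc laws x' y z').
rewrite (bil_cyc laws z x' y').
by ring.
Qed.

Lemma symmetry_psi t : is_symmetry (frd_psi t).
Proof.
split.
- exact: frd_psi_linear.
- exists (frd_psi (- t)); first exact: frd_psiK.
  by rewrite -{2}(opprK t); exact: frd_psiK.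
- exact: quart_psi.
elim/frdhP=> al be a1 a2 a3 x y z b1 b2 b3 x' y' z'.
elim/frdhP=> ga de c1 c2 c3 u v w d1 d2 d3 u' v' w'.
rewrite !frd_psiE !sympE !jtraceE !linE (bilC x' u').
by ring.
Qed.

End Freudenthal.

(** * Polarized forms *)

Section Polarization.
Variables (V : zmodType).
Implicit Types (f : V -> rat).

Lemma sum_setS n (F : {set 'I_n.+1} -> rat) : \sum_(S : {set 'I_n.+1}) F S =
  \sum_(S : {set 'I_n}) (F (ord0 |: lift ord0 @: S) + F (lift ord0 @: S)).
Proof.
pose h (S : {set 'I_n}) := lift ord0 @: S.
pose h' (S : {set 'I_n.+1}) := lift ord0 @^-1: S.
have inj0 : injective (lift (@ord0 n)) by exact: lift_inj.
have hN S : (ord0 \in h S) = false.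
  by apply/imsetP => -[i _] /eqP; rewrite (negPf (neq_lift _ _)).
rewrite (bigID (fun S : {set 'I_n.+1} => ord0 \in S)) big_split /=.
congr (_ + _).
  rewrite (reindex_onto (fun S => ord0 |: h S) h') /=; last first.
    move=> S S0; apply/setP => i; rewrite !inE.
    have [->|] := eqVneq i ord0; first by rewrite S0.
    by case: (unliftP ord0 i) => [j ->|-> //] _; rewrite mem_imset ?inE.
  apply: eq_bigl => S; rewrite setU11 /=; apply/eqP/setP => i.
  by rewrite !inE eq_sym (negPf (neq_lift _ _)) mem_imset.
rewrite (reindex_onto h h') /=; last first.
  move=> S S0; apply/setP => i.
  case: (unliftP ord0 i) => [j ->|->]; first by rewrite mem_imset ?inE.
  by rewrite hN (negPf S0).
apply: eq_bigl => S; rewrite hN /=; apply/eqP/setP => i.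
by rewrite !inE mem_imset.
Qed.

Definition alt_sum n f (v : n.-tuple V) : rat :=
  \sum_(S : {set 'I_n}) (-1) ^+ (n - #|S|)%N * f (\sum_(i in S) tnth v i).

Lemma alt_sum0 f v : @alt_sum 0 f v = f 0.
Proof.
rewrite /alt_sum (big_pred1 finset.set0); last first.
  by move=> S; apply/esym/eqP/setP => -[].
by rewrite big_set0 mul1r.
Qed.

(** Polarization is an iterated finite difference. *)
Lemma alt_sumS n f x (v : n.-tuple V) :
  alt_sum f [tuple of x :: v] = alt_sum (fun y => f (x + y) - f y) v.
Proof.
rewrite /alt_sum sum_setS; apply: eq_bigr => S _.
have inj0 : injective (lift (@ord0 n)) by exact: lift_inj.
have S0 : ord0 \notin lift ord0 @: S.
  by apply/imsetP => -[i _] /eqP; rewrite (negPf (neq_lift _ _)).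
have sumE : \sum_(i in lift ord0 @: S) tnth [tuple of x :: v] i =
    \sum_(i in S) tnth v i.
  rewrite big_imset /=; last by move=> ? ? _ _; exact: inj0.
  by apply: eq_bigr => i _; rewrite tnthS.
rewrite big_setU1 //= sumE tnth0 cardsU1 S0 card_imset // add1n subSS.
have le : (#|S| <= n)%N by rewrite -[n in (_ <= n)%N]card_ord max_card.
by rewrite subSn // exprS; ring.
Qed.

Lemma polar3E f x y z : polar f [tuple x; y; z] = 6^-1 *
  (f (x + (y + z)) - f (y + z) - (f (x + z) - f z)
   - (f (x + y) - f y - (f x - f 0))).
Proof.
rewrite /polar -/(alt_sum f _).
have -> : [tuple x; y; z] =
    [tuple of x :: [tuple of y :: [tuple of z :: [tuple]]]].
  exact: val_inj.
by rewrite !alt_sumS alt_sum0 !addr0.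
Qed.

Lemma polar4E f x y z w : polar f [tuple x; y; z; w] = 24^-1 *
  (f (x + (y + (z + w))) - f (y + (z + w)) - (f (x + (z + w)) - f (z + w))
   - (f (x + (y + w)) - f (y + w) - (f (x + w) - f w))
   - (f (x + (y + z)) - f (y + z) - (f (x + z) - f z)
   - (f (x + y) - f y - (f x - f 0)))).
Proof.
rewrite /polar -/(alt_sum f _).
have -> : [tuple x; y; z; w] =
    [tuple of x :: [tuple of y :: [tuple of z :: [tuple of w :: [tuple]]]]].
  exact: val_inj.
by rewrite !alt_sumS alt_sum0 !addr0.
Qed.

End Polarization.

Section PolarForms.
Variable (C : comp_ring rat) (hyp : seq (C * C)).
Hypothesis laws : composition_laws hyp.
Implicit Types (A B : herm3 C) (x y z w : freudenthal C).

Lemma polar_cubic A B :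
  3 * polar (@cubic _ C) [tuple A; A; B] = jtrace (jsharp A) B.
Proof.
rewrite polar3E !(cubicD laws) !(jsharpD laws) !(jtraceDr laws) (cubic0 laws).
rewrite (jtraceC A (jcross A B)) (jcrossC laws A) (jtrace_cross_cyc laws B A A).
rewrite (jcrossxx laws) (jtraceZl laws).
by field.
Qed.

Section Quartic.
Variables (a b c d : rat) (A B D E : herm3 C) (a' b' c' d' : rat).
Variables (A' B' D' E' : herm3 C).

Local Notation tr := (@jtrace _ C).
Local Notation X := (@jcross _ C).

(** The complete linearization of the quartic form at four points, written
    with the cross product so that it is visibly linear in each of them. *)
Definition full_quart : rat :=
  8 * (tr (X A B) (X D' E') + tr (X A D) (X B' E') + tr (X A E) (X B' D')
     + tr (X B D) (X A' E') + tr (X B E) (X A' D') + tr (X D E) (X A' B'))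
  - 8 * (a * tr B (X D E) + b * tr A (X D E) + c * tr A (X B E)
       + d * tr A (X B D))
  - 8 * (a' * tr B' (X D' E') + b' * tr A' (X D' E') + c' * tr A' (X B' E')
       + d' * tr A' (X B' D'))
  - 4 * ((tr A B' + tr B A' - a * b' - b * a') *
           (tr D E' + tr E D' - c * d' - d * c')
       + (tr A D' + tr D A' - a * c' - c * a') *
           (tr B E' + tr E B' - b * d' - d * b')
       + (tr A E' + tr E A' - a * d' - d * a') *
           (tr B D' + tr D B' - b * c' - c * b')).

Lemma polar_quart : polar (@quart _ C)
    [tuple frd a a' A A'; frd b b' B B'; frd c c' D D'; frd d d' E E'] =
  24^-1 * full_quart.
Proof.
rewrite polar4E; congr (_ * _); rewrite /full_quart.
rewrite frd0 !frdD !quartE !(cubicD laws) !(jsharpD laws) !(jcrossDr laws).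
rewrite (jsharp0 laws) !(jtrace0l laws) (cubic0 laws).
rewrite !(jtraceDr laws) !(jtraceDl laws).
by ring.
Qed.
End Quartic.
End PolarForms.

(** * Duality *)

Section Duality.
Variables (R : comNzRingType) (C : comp_ring R) (hyp : seq (C * C)).
Hypothesis laws : composition_laws hyp.
Local Notation bil := (@c_bil R C).

(** The dual basis makes the norm form unimodular, so linear forms are
    represented over the base ring itself, integers included. *)
Lemma bil_rep (f : C -> R) : scalar f -> exists d, forall x, bil d x = f x.
Proof.
move=> lf; exists (\sum_(p <- hyp) f p.1 *: p.2) => x.
have fD y z : f (y + z) = f y + f z by rewrite -{1}[y]scale1r lf mul1r.
have f0 : f 0 = 0 by apply: (addrI (f 0)); rewrite -fD !addr0.
rewrite [in RHS](hyp_dual laws x) (big_morph f fD f0).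
rewrite (big_morph (bil^~ x) (id1 := 0) (op1 := +%R)); last 2 first.
- by move=> y z; rewrite (bilDl laws).
- exact: (bil0l laws).
apply: eq_bigr => p _; rewrite (bilZl laws) -[_ *: p.1]addr0 lf f0 addr0.
by rewrite bilC mulrC.
Qed.

Lemma jtrace_rep (f : herm3 C -> R) :
  scalar f -> exists A, forall B, jtrace A B = f B.
Proof.
move=> lf.
have fD y z : f (y + z) = f y + f z by rewrite -{1}[y]scale1r lf mul1r.
have f0 : f 0 = 0 by apply: (addrI (f 0)); rewrite -fD !addr0.
have fZ r y : f (r *: y) = r * f y by rewrite -[_ *: y]addr0 lf f0 addr0.
have hE (a b c : R) (x y z : C) : herm a b c x y z =
    a *: herm 1 0 0 0 0 0 + b *: herm 0 1 0 0 0 0 + c *: herm 0 0 1 0 0 0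
    + herm 0 0 0 x 0 0 + herm 0 0 0 0 y 0 + herm 0 0 0 0 0 z.
  by rewrite !hermZ !hermD !scaler0 !mulr0 !mulr1 !addr0 !add0r.
have [d1 h1] : exists d, forall x, bil d x = f (herm 0 0 0 x 0 0).
  apply: bil_rep => r x y; rewrite -fZ -fD hermZ hermD.
  by rewrite !mulr0 !scaler0 !addr0.
have [d2 h2] : exists d, forall x, bil d x = f (herm 0 0 0 0 x 0).
  apply: bil_rep => r x y; rewrite -fZ -fD hermZ hermD.
  by rewrite !mulr0 !scaler0 !addr0.
have [d3 h3] : exists d, forall x, bil d x = f (herm 0 0 0 0 0 x).
  apply: bil_rep => r x y; rewrite -fZ -fD hermZ hermD.
  by rewrite !mulr0 !scaler0 !addr0.
exists (herm (f (herm 1 0 0 0 0 0)) (f (herm 0 1 0 0 0 0)) 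
  (f (herm 0 0 1 0 0 0)) d1 d2 d3).
elim/hermP=> a b c x y z; rewrite jtraceE [in RHS]hE !fD !fZ h1 h2 h3.
by ring.
Qed.

Lemma symp_rep (f : freudenthal C -> R) :
  scalar f -> exists x, forall w, symp x w = f w.
Proof.
move=> lf.
have fD y z : f (y + z) = f y + f z by rewrite -{1}[y]scale1r lf mul1r.
have f0 : f 0 = 0 by apply: (addrI (f 0)); rewrite -fD !addr0.
have fZ r y : f (r *: y) = r * f y by rewrite -[_ *: y]addr0 lf f0 addr0.
have hE (a b : R) (A B : herm3 C) : frd a b A B =
    a *: frd 1 0 0 0 + b *: frd 0 1 0 0 + frd 0 0 A 0 + frd 0 0 0 B.
  by rewrite !frdZ !frdD !scaler0 !mulr0 !mulr1 !addr0 !add0r.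
have [A hA] : exists d, forall B, jtrace d B = f (frd 0 0 0 B).
  apply: jtrace_rep => r x y; rewrite -fZ -fD frdZ frdD.
  by rewrite !mulr0 !scaler0 !addr0.
have [B hB] : exists d, forall A, jtrace d A = f (frd 0 0 A 0).
  apply: jtrace_rep => r x y; rewrite -fZ -fD frdZ frdD.
  by rewrite !mulr0 !scaler0 !addr0.
exists (frd (f (frd 0 1 0 0)) (- f (frd 1 0 0 0)) A (- B)).
elim/frdP=> a b D E; rewrite sympE [in RHS]hE !fD !fZ (jtraceNl laws) hA hB.
by ring.
Qed.

End Duality.

Section Extension.
Variable k : comp_kind.
Local Notation CZ := (comp_alg k int).
Local Notation CQ := (comp_alg k rat).
Local Notation JZ := (herm3 CZ).
Local Notation JQ := (herm3 CQ).
Local Notation MZ := (freudenthal CZ).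
Local Notation MQ := (freudenthal CQ).
Let lawsZ := comp_alg_laws k int.
Let lawsQ := comp_alg_laws k rat.

Lemma herm3_toQE (a b c : int) (x y z : CZ) : herm3_toQ (herm a b c x y z) =
  herm a%:~R b%:~R c%:~R (comp_toQ x) (comp_toQ y) (comp_toQ z).
Proof. by rewrite !herm_tuple. Qed.

Lemma toQE (a b : int) (A B : JZ) : toQ (frd a b A B) =
  frd a%:~R b%:~R (herm3_toQ A) (herm3_toQ B).
Proof. by rewrite !frd_melt. Qed.

Lemma comp_toQ_0 : comp_toQ (0 : CZ) = 0.
Proof.
by apply: (addrI (comp_toQ 0)); rewrite -comp_toQ_D !addr0.
Qed.

Lemma herm3_toQ_D (A B : JZ) : herm3_toQ (A + B) = herm3_toQ A + herm3_toQ B.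
Proof.
elim/hermP: A => *; elim/hermP: B => *.
by rewrite hermD !herm3_toQE hermD !comp_toQ_D !rmorphD.
Qed.

Lemma herm3_toQ_0 : herm3_toQ (0 : JZ) = 0.
Proof. by rewrite herm0 herm3_toQE !comp_toQ_0 herm0. Qed.

Lemma toQ_D (x y : MZ) : toQ (x + y) = toQ x + toQ y.
Proof.
elim/frdP: x => *; elim/frdP: y => *.
by rewrite frdD !toQE frdD !herm3_toQ_D !rmorphD.
Qed.

Lemma toQ_0 : toQ (0 : MZ) = 0.
Proof.
by rewrite frd0 toQE frd0 !herm3_toQ_0.
Qed.

Lemma comp_toQ_Z (r : int) (x : CZ) : comp_toQ (r *: x) = r%:~R *: comp_toQ x.
Proof.
have Z (A : 'M[int]_2) :
    map_mx intr (r *: A) = r%:~R *: map_mx intr A :> 'M[rat]_2.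
  by apply/matrixP => i j; rewrite !mxE rmorphM.
rewrite /CZ; case: k x => /= [x||[x y]].
- by apply: val_inj; rewrite /= Z.
- exact: Z.
by rewrite octZ /= !Z.
Qed.

Lemma comp_toQ_B (x y : CZ) : comp_toQ (x - y) = comp_toQ x - comp_toQ y.
Proof. by rewrite -!scaleN1r comp_toQ_D comp_toQ_Z. Qed.

Lemma toQ_Z (r : int) (x : MZ) : toQ (r *: x) = r%:~R *: toQ x.
Proof.
elim/frdhP: x => *; rewrite !(hermE, frdE) !toQE !herm3_toQE !(hermE, frdE).
by rewrite !comp_toQ_Z !rmorphM.
Qed.

Lemma herm3_toQ_jtrace (A B : JZ) :
  jtrace (herm3_toQ A) (herm3_toQ B) = (jtrace A B)%:~R.
Proof.
elim/hermP: A => *; elim/hermP: B => *.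
by rewrite !herm3_toQE !jtraceE !comp_toQ_bil !(rmorphD, rmorphM).
Qed.

Lemma toQ_symp (x y : MZ) : symp (toQ x) (toQ y) = (symp x y)%:~R.
Proof.
elim/frdP: x => *; elim/frdP: y => *.
by rewrite !toQE !sympE !herm3_toQ_jtrace !(rmorphB, rmorphD, rmorphM).
Qed.


Lemma herm3_toQ_sharp (A : JZ) : herm3_toQ (jsharp A) = jsharp (herm3_toQ A).
Proof.
elim/hermP: A => *.
rewrite jsharpE !herm3_toQE jsharpE !comp_toQ_norm -!comp_toQ_para -!comp_toQ_Z.
by rewrite -!comp_toQ_B !(rmorphB, rmorphM).
Qed.

Lemma herm3_toQ_cubic (A : JZ) : cubic (herm3_toQ A) = (cubic A)%:~R.
Proof.
elim/hermP: A => *.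
rewrite herm3_toQE (cubic_herm lawsQ) (cubic_herm lawsZ) !comp_toQ_norm.
by rewrite -comp_toQ_para comp_toQ_bil !(rmorphB, rmorphD, rmorphM).
Qed.


Lemma toQ_quart (x : MZ) : quart (toQ x) = (quart x)%:~R.
Proof.
elim/frdP: x => *.
rewrite toQE !quartE -!herm3_toQ_sharp !herm3_toQ_cubic !herm3_toQ_jtrace.
by rewrite !(rmorphB, rmorphD, rmorphM, rmorphXn).
Qed.

(** [polar_cubic] shows that [jsharp] satisfies the defining condition of the
    sharp map, and the trace form allows only one solution. *)
Lemma sharp_jsharp (A : JQ) : sharp A = jsharp A.
Proof.
have ex : exists S : JQ, forall B, jtrace S B = 3 * cubic3 A A B.
  by exists (jsharp A) => B; rewrite /cubic3 (polar_cubic lawsQ).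
apply: (jtrace_inj lawsQ) => B.
by rewrite (xgetPex 0 ex) /cubic3 (polar_cubic lawsQ).
Qed.

Lemma quartic_quart (x : MQ) : quartic x = quart x.
Proof.
elim/frdP: x => *; rewrite quartE frd_melt /quartic /melt.
by rewrite !sharp_jsharp.
Qed.

Lemma qZE (x : MZ) : qZ x = (quart x)%:~R.
Proof. by rewrite /qZ quartic_quart toQ_quart. Qed.

Lemma quartic4E (a b c d a' b' c' d' : rat) (A B D E A' B' D' E' : JQ) :
  quartic4 (frd a a' A A') (frd b b' B B') (frd c c' D D') (frd d d' E E') =
  24^-1 * full_quart a b c d A B D E a' b' c' d' A' B' D' E'.
Proof.
rewrite /quartic4 -(polar_quart lawsQ).
by congr (polar _ _); apply/funext => x; exact: quartic_quart.
Qed.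

(** The linear form q(x, y, z, .) is represented by a vector because the
    symplectic form is nondegenerate. *)
Lemma triple_exists (x y z : MQ) :
  exists t : MQ, forall w, symp t w = quartic4 x y z w.
Proof.
apply: (symp_rep lawsQ) => r w w'.
elim/frdP: x => a a' A A'; elim/frdP: y => b b' B B'.
elim/frdP: z => c c' D D'; elim/frdP: w => d d' E E'.
elim/frdP: w' => e e' F F'.
rewrite frdZ frdD !quartic4E /full_quart.
rewrite !(jcrossDr lawsQ) !(jtraceDr lawsQ) !(jtraceDl lawsQ).
have jcrossZr s P Q : jcross P (s *: Q : JQ) = s *: jcross P Q.
  by rewrite (jcrossC lawsQ) (jcrossZl lawsQ) (jcrossC lawsQ).
rewrite !jcrossZr !(jtraceZl lawsQ) !(jtraceZr lawsQ).
by ring.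
Qed.

Lemma symp_triple (x y z w : MQ) : symp (triple x y z) w = quartic4 x y z w.
Proof. exact: (xgetPex 0 (triple_exists x y z)). Qed.

Lemma comp_toQ_nondeg (u : CQ) : (forall w, c_bil u (comp_toQ w) = 0) -> u = 0.
Proof.
move=> h; rewrite (hyp_dual lawsQ u) hyp_basis_toQ big_map big1 // => p _ /=.
by rewrite h scale0r.
Qed.

Lemma herm3_toQ_nondeg (A : JQ) :
  (forall B, jtrace A (herm3_toQ B) = 0) -> A = 0.
Proof.
elim/hermP: A => a b c x y z H; rewrite herm0.
have T a' b' c' x' y' z' : a * a'%:~R + b * b'%:~R + c * c'%:~R
    + c_bil x (comp_toQ x') + c_bil y (comp_toQ y') + c_bil z (comp_toQ z') = 0.
  by have := H (herm a' b' c' x' y' z'); rewrite herm3_toQE jtraceE.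
have b0 (u : CQ) : c_bil u (comp_toQ 0) = 0 by rewrite comp_toQ_0 (bil0r lawsQ).
congr herm; try (apply: comp_toQ_nondeg => w).
- by have := T 1 0 0 0 0 0; rewrite !b0 => /eq_by_diff; apply; ring.
- by have := T 0 1 0 0 0 0; rewrite !b0 => /eq_by_diff; apply; ring.
- by have := T 0 0 1 0 0 0; rewrite !b0 => /eq_by_diff; apply; ring.
- by have := T 0 0 0 w 0 0; rewrite !b0 => /eq_by_diff; apply; ring.
- by have := T 0 0 0 0 w 0; rewrite !b0 => /eq_by_diff; apply; ring.
by have := T 0 0 0 0 0 w; rewrite !b0 => /eq_by_diff; apply; ring.
Qed.

(** Lattice vectors suffice as test vectors because the hyperbolic basis is
    defined over the integers. *)
Lemma toQ_nondeg (t : MQ) : (forall w : MZ, symp t (toQ w) = 0) -> t = 0.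
Proof.
elim/frdP: t => al be A B H.
have T (ga de : int) D E : al * de%:~R - be * ga%:~R
    + jtrace A (herm3_toQ E) - jtrace B (herm3_toQ D) = 0.
  by have := H (frd ga de D E); rewrite toQE sympE.
have t0 (D : JQ) : jtrace D (herm3_toQ 0) = 0.
  by rewrite herm3_toQ_0 (jtrace0r lawsQ).
rewrite frd0; congr frd; try (apply: herm3_toQ_nondeg => D).
- by have := T 0 1 0 0; rewrite !t0 => /eq_by_diff; apply; ring.
- by have := T (-1) 0 0 0; rewrite !t0 => /eq_by_diff; apply; ring.
- by have := T 0 0 0 D; rewrite !t0 => /eq_by_diff; apply; ring.
have /esym/eq_by_diff := T 0 0 D 0; rewrite !t0; apply; ring.
Qed.

Lemma symp_toQ_inj (s t : MQ) :
  (forall w : MZ, symp s (toQ w) = symp t (toQ w)) -> s = t.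
Proof.
move=> st; apply/eqP; rewrite -subr_eq0; apply/eqP/toQ_nondeg => w.
have stw := st w; clear st; move: s t stw.
elim/frdP=> ????; elim/frdP=> ????.
elim/frdP: w => ????; rewrite frdN frdD toQE !sympE.
rewrite !(jtraceDl lawsQ) !(jtraceNl lawsQ).
by move/eq_by_diff; apply; ring.
Qed.

(** The lattice is self-dual for the symplectic form, so divisibility in it can
    be tested on the values of the form. *)
Lemma divides_symp (d : int) (m : MQ) : divides d m <->
  forall w : MZ, exists e : int, symp m (toQ w) = (d * e)%:~R.
Proof.
split=> [[m' ->] w|H].
  exists (symp m' w); rewrite toQ_symp; elim/frdP: m' => *; elim/frdP: w => *.
  rewrite frdZ !sympE !(jtraceZl lawsZ); congr (_%:~R).
  by ring.
have [d0|d0] := eqVneq d 0.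
  exists 0; rewrite d0 scale0r toQ_0; apply: toQ_nondeg => w.
  by have [e ->] := H w; rewrite d0 mul0r.
have [e he] := choice H.
have [m' hm'] : exists m' : MZ, forall w, symp m' w = e w.
  apply: (symp_rep lawsZ) => r x y; apply: (mulfI d0); apply: (@intr_inj rat).
  rewrite -he toQ_D toQ_Z mulrDr rmorphD mulrCA rmorphM /= -!he.
  elim/frdP: m {H he} => *; elim/frdP: x => *; elim/frdP: y => *.
  rewrite !toQE frdZ frdD !sympE !(jtraceDr lawsQ) !(jtraceZr lawsQ).
  by ring.
exists m'; apply: symp_toQ_inj => w; rewrite he -hm' toQ_symp; congr (_%:~R).
elim/frdP: m' hm' => *; elim/frdP: w => *.
rewrite frdZ !sympE !(jtraceZl lawsZ).
by ring.
Qed.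

End Extension.

(** * Orbits *)

Section Orbits.
Variable k : comp_kind.
Local Notation CZ := (comp_alg k int).
Local Notation JZ := (herm3 CZ).
Local Notation MZ := (freudenthal CZ).
Let laws := comp_alg_laws k int.
Local Notation linE := (linE laws).
Implicit Types (al be t : int) (A B D : JZ) (u v w : CZ).

Lemma symmetry_Inv (f : MZ -> MZ) : is_symmetry f ->
  exists g : {linear MZ -> MZ}, is_Inv g /\ g =1 f.
Proof.
case=> lf bf qf sf.
pose g : {linear MZ -> MZ} := HB.pack f (GRing.isLinear.Build _ _ _ _ f lf).
by exists g; split=> //; split=> // x; rewrite !qZE qf.
Qed.

Lemma orbit_symmetry (f : MZ -> MZ) x : is_symmetry f -> same_orbit x (f x).
Proof. by move=> /symmetry_Inv[g [ig gf]]; exists g. Qed.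

Lemma orbit_trans (x y z : MZ) :
  same_orbit x y -> same_orbit y z -> same_orbit x z.
Proof.
move=> [g [[bg qg sg] <-]] [h [[bh qh sh] <-]].
exists (h \o g); split=> //; split.
- exact: bij_comp.
- by move=> u; rewrite /= qh qg.
by move=> u v; rewrite /= sh sg.
Qed.

Lemma orbit_sym (x y : MZ) : same_orbit x y -> same_orbit y x.
Proof.
move=> [g [[[g' gK g'K] qg sg] <-]].
have lg' : linear g' := can2_linear gK g'K.
pose h : {linear MZ -> MZ} := HB.pack g' (GRing.isLinear.Build _ _ _ _ g' lg').
exists h; split; last exact: gK.
split; first by exists g.
- by move=> z; rewrite -qg [g _]g'K.
by move=> z w; rewrite -sg ![g _]g'K.
Qed.

Lemma orbit_refl (x : MZ) : same_orbit x x.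
Proof.
by apply: (orbit_trans (orbit_symmetry x (symmetryN laws))); apply: orbit_sym;
  exact: orbit_symmetry (symmetryN laws).
Qed.

Section Orbit.
Variable x0 : MZ.
Local Notation O := (same_orbit x0).

Lemma orb_cyc al be A B : O (frd al be A B) -> O (frd al be (jcyc A) (jcyc B)).
Proof.
move/orbit_trans; apply; rewrite -frd_cycE.
exact: orbit_symmetry (symmetry_cyc laws).
Qed.

Lemma orb_elem12 u al be A B :
  O (frd al be A B) -> O (frd al be (elem12 u A) (elem21 (- u) B)).
Proof.
move/orbit_trans; apply; rewrite -frd12E.
exact: orbit_symmetry (symmetry12 laws u).
Qed.

Lemma orb_elem21 u al be A B :
  O (frd al be A B) -> O (frd al be (elem21 u A) (elem12 (- u) B)).
Proof.
move/orbit_trans; apply; rewrite -frd21E.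
exact: orbit_symmetry (symmetry21 laws u).
Qed.

Lemma orb_opp al be A B :
  O (frd al be A B) -> O (frd (- al) (- be) (- A) (- B)).
Proof.
move/orbit_trans; apply; rewrite -frdN.
exact: orbit_symmetry (symmetryN laws).
Qed.

Lemma orb_J al be A B : O (frd al be A B) -> O (frd (- be) al (- B) A).
Proof.
move/orbit_trans; apply; rewrite -frdJE.
exact: orbit_symmetry (symmetryJ laws).
Qed.

Lemma orb_psi t al be a1 a2 a3 x y z b1 b2 b3 x' y' z' :
  O (frd al be (herm a1 a2 a3 x y z) (herm b1 b2 b3 x' y' z')) ->
  O (frd al (be + t * a1)
    (herm a1 (a2 + t * b3) (a3 + t * b2) (x - t *: x') y z)
    (herm (b1 + t * al) b2 b3 x' y' z')).
Proof.
move/orbit_trans; apply; rewrite -frd_psiE.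
exact: orbit_symmetry (symmetry_psi laws t).
Qed.

(** Conjugating [frd_psi] by [frdJ] exchanges the roles of the two halves. *)
Lemma orb_phi t al be a1 a2 a3 x y z b1 b2 b3 x' y' z' :
  O (frd al be (herm a1 a2 a3 x y z) (herm b1 b2 b3 x' y' z')) ->
  O (frd (al + t * b1) be
    (herm (a1 + t * be) a2 a3 x y z)
    (herm b1 (b2 + t * a3) (b3 + t * a2) (x' - t *: x) y' z')).
Proof.
move/orb_J; rewrite hermN => /(orb_psi (- t)) /orb_J /orb_opp.
rewrite !(hermN, opprK, scaleNr, opprD) !mulNr !mulrN !opprK.
by [].
Qed.

Lemma dvd_comp (a : int) (z : CZ) :
  (forall p, p \in hyp_basis k int -> (a %| c_bil z p.2)%Z) ->
  exists z', z = a *: z'.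
Proof.
move=> H; exists (\sum_(p <- hyp_basis k int) (c_bil z p.2 %/ a)%Z *: p.1).
rewrite scaler_sumr {1}(hyp_dual laws z) !big_seq; apply: eq_bigr => p hp.
by rewrite scalerA mulrC divzK ?H.
Qed.

End Orbit.

(** Serves to clear the last component once al divides it; only the two middle
    components are disturbed. *)
Definition shiftable D := forall al be A B, exists be' A',
  same_orbit (frd al be A B) (frd al be' A' (B + al *: D)).

Lemma shiftableD D D' : shiftable D -> shiftable D' -> shiftable (D + D').
Proof.
move=> sD sD' al be A B.
have [be1 [A1 o1]] := sD al be A B.
have [be2 [A2 o2]] := sD' al be1 A1 (B + al *: D).
by exists be2, A2; rewrite scalerDr addrA; exact: orbit_trans o2.
Qed.

Lemma shiftable_map (f g f' g' : JZ -> JZ) D :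
  cancel g f -> cancel g' f' -> linear f' ->
  (forall al be A B, same_orbit (frd al be A B) (frd al be (f A) (f' B))) ->
  shiftable D -> shiftable (f' D).
Proof.
move=> gK gK' lf o sD al be A B.
have /orbit_sym := o al be (g A) (g' B); rewrite gK gK' => o1.
have [be1 [A1 o2]] := sD al be (g A) (g' B).
exists be1, (f A1); apply: orbit_trans o1 (orbit_trans o2 _).
have := o al be1 A1 (g' B + al *: D).
rewrite [X in f' X]addrC lf gK' [X in frd _ _ (f A1) X]addrC. exact.
Qed.

Lemma shiftable_cyc D : shiftable D -> shiftable (jcyc D).
Proof.
move=> sD; refine (@shiftable_map (@jcyc _ _) (@jcyc _ _ \o @jcyc _ _)
  (@jcyc _ _) (@jcyc _ _ \o @jcyc _ _) D _ _ _ _ sD).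
- by move=> A; rewrite /= jcycK.
- by move=> A; rewrite /= jcycK.
- exact: jcyc_linear.
by move=> al be A B; apply: orb_cyc; exact: orbit_refl.
Qed.

Lemma shiftable_elem21 u D : shiftable D -> shiftable (elem21 u D).
Proof.
move=> sD; refine (@shiftable_map (elem12 (- u)) (elem12 u)
  (elem21 u) (elem21 (- u)) D _ _ _ _ sD).
- exact: (elem12K laws).
- by rewrite -{2}(opprK u); exact: (elem21K laws).
- exact: (elem21_linear laws).
move=> al be A B; rewrite -{2}(opprK u); apply: orb_elem12.
exact: orbit_refl.
Qed.

Lemma shiftable1 t : shiftable (herm t 0 0 0 0 0).
Proof.
move=> al be; elim/hermP=> a1 a2 a3 x y z; elim/hermP=> b1 b2 b3 x' y' z'.
do 2 eexists; rewrite hermZ hermD !(mulr0, scaler0, addr0) mulrC.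
exact: orb_psi (orbit_refl _).
Qed.

(** The exponentials give the multiples of diag(1,0,0), the permutations the
    other diagonal matrices, and [elem21 u] maps diag(1,0,0) to a matrix with
    off-diagonal entry u. *)
Lemma shiftable_all D : shiftable D.
Proof.
have s2 t : shiftable (herm 0 t 0 0 0 0).
  by have := shiftable_cyc (shiftable_cyc (shiftable1 t)); rewrite !jcycE.
have s3 t : shiftable (herm 0 0 t 0 0 0).
  by have := shiftable_cyc (shiftable1 t); rewrite !jcycE.
have s6 u : shiftable (herm 0 0 0 0 0 u).
  have := shiftableD (shiftable_elem21 u (shiftable1 1))
    (shiftableD (shiftable1 (-1)) (s2 (- c_norm u))).
  rewrite elem21E !hermD !linE !(mul1r, scale1r, addr0, add0r).
  by rewrite !subrr.
have s5 u : shiftable (herm 0 0 0 0 u 0).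
  have := shiftable_cyc (shiftable_cyc (shiftable_cyc (shiftable_cyc (s6 u)))).
  by rewrite !jcycE.
have s4 u : shiftable (herm 0 0 0 u 0 0).
  by have := shiftable_cyc (shiftable_cyc (s6 u)); rewrite !jcycE.
elim/hermP: D => a b c x y z.
have := shiftableD (shiftable1 a) (shiftableD (s2 b) (shiftableD (s3 c)
  (shiftableD (s4 x) (shiftableD (s5 y) (s6 z))))).
by rewrite !hermD !(addr0, add0r).
Qed.

(** Divisibility of the corner b1 by a is only assumed at the elements of the
    orbit with first coordinate a. The symmetries that fix this coordinate then
    spread it over all the other coordinates. *)
Section Minimal.
Variables (x0 : MZ) (a : int).
Local Notation O := (same_orbit x0).
Hypothesis corner_dvd : forall be A b1 b2 b3 x y z,
  O (frd a be A (herm b1 b2 b3 x y z)) -> (a %| b1)%Z.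

Lemma dvd_diagB be A b1 b2 b3 x y z :
  O (frd a be A (herm b1 b2 b3 x y z)) ->
  [/\ (a %| b1)%Z, (a %| b2)%Z & (a %| b3)%Z].
Proof.
move=> o; have o1 := orb_cyc o; have o2 := orb_cyc o1.
rewrite !jcycE in o1 o2.
by split; [exact: corner_dvd o|exact: corner_dvd o1|exact: corner_dvd o2].
Qed.

Lemma dvd_offB be A b1 b2 b3 x y z :
  O (frd a be A (herm b1 b2 b3 x y z)) -> exists z', z = a *: z'.
Proof.
move=> o; apply: dvd_comp => p _; set v := p.2.
have [d1 d2 _] := dvd_diagB o.
have := orb_elem12 v o; rewrite elem21E => /dvd_diagB[_ + _].
rewrite !linE => d3.
have -> : c_bil z v = b2 + b1 * c_norm v - (b2 - c_bil z v + b1 * c_norm v).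
  by ring.
by rewrite rpredB // rpredD // dvdz_mulr.
Qed.

Lemma herm_divides (b1 b2 b3 : int) (x y z : CZ) :
  (a %| b1)%Z -> (a %| b2)%Z -> (a %| b3)%Z ->
  (exists x', x = a *: x') -> (exists y', y = a *: y') ->
  (exists z', z = a *: z') -> exists B, herm b1 b2 b3 x y z = a *: B.
Proof.
move=> /dvdzP[c1 ->] /dvdzP[c2 ->] /dvdzP[c3 ->] [x' ->] [y' ->] [z' ->].
by exists (herm c1 c2 c3 x' y' z'); rewrite hermZ; congr herm; rewrite mulrC.
Qed.

Lemma dvd_B be A B : O (frd a be A B) -> exists B', B = a *: B'.
Proof.
elim/hermP: B => b1 b2 b3 x y z o.
have [d1 d2 d3] := dvd_diagB o.
have o1 := orb_cyc o; have o2 := orb_cyc o1; rewrite !jcycE in o1 o2.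
apply: herm_divides => //.
- exact: dvd_offB o1.
- exact: dvd_offB o2.
exact: dvd_offB o.
Qed.

(** The exponential with parameter -b1/a clears b1; then the opposite one
    leaves a unchanged and adds to b2 the new third diagonal entry, a3 -
    (b1/a) b2. So a divides this entry, and it divides b1 and b2. *)
Lemma dvd_A3 be a1 a2 a3 x y z B :
  O (frd a be (herm a1 a2 a3 x y z) B) -> (a %| a3)%Z.
Proof.
elim/hermP: B => b1 b2 b3 x' y' z' o.
have [/dvdzP[c1 e1] d2 _] := dvd_diagB o.
have := orb_phi 1 (orb_psi (- c1) o).
have -> : a + 1 * (b1 + - c1 * a) = a by rewrite e1; ring.
move=> /dvd_diagB[_ d _].
have -> : a3 = b2 + 1 * (a3 + - c1 * b2) - (b2 + - c1 * b2) by ring.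
by rewrite rpredB // rpredD // dvdz_mull.
Qed.

Lemma dvd_A be A B : O (frd a be A B) -> exists A', A = a *: A'.
Proof.
have diag A1 be1 B1 : O (frd a be1 A1 B1) -> let: (a1, a2, a3, _, _, _) := A1 in
    [/\ (a %| a1)%Z, (a %| a2)%Z & (a %| a3)%Z].
  elim/hermP: A1 => a1 a2 a3 x y z o; rewrite herm_tuple.
  have o1 := orb_cyc o; have o2 := orb_cyc o1; rewrite !jcycE in o1 o2.
  by split; [exact: dvd_A3 o1|exact: dvd_A3 o2|exact: dvd_A3 o].
have off be1 a1 a2 a3 x y z B1 :
    O (frd a be1 (herm a1 a2 a3 x y z) B1) -> exists z', z = a *: z'.
  move=> o; apply: dvd_comp => p _; set v := p.2.
  have := diag _ _ _ o; rewrite herm_tuple => -[d1 d2 _].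
  have := diag _ _ _ (orb_elem12 v o); rewrite elem12E herm_tuple => -[d3 _ _].
  have -> : c_bil z v = (a1 + c_bil z v + a2 * c_norm v) - (a1 + a2 * c_norm v).
    by ring.
  by rewrite rpredB // rpredD // dvdz_mulr.
elim/hermP: A => a1 a2 a3 x y z o.
have := diag _ _ _ o; rewrite {1}herm_tuple => -[d1 d2 d3].
have o1 := orb_cyc o; have o2 := orb_cyc o1; rewrite !jcycE in o1 o2.
by apply: herm_divides; [..|exact: off o1|exact: off o2|exact: off o].
Qed.

Lemma corner_dvd_reduction be A B : O (frd a be A B) -> exists be' A',
  O (frd a (a * be') (a *: A') 0).
Proof.
move=> o; have [B' eB] := dvd_B o.
have [be1 [A1]] := shiftable_all (- B') a be A B.
rewrite eB scalerN subrr -eB => /(orbit_trans o) {o eB} o.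
have [A' eA] := dvd_A o; exists (be1 %/ a)%Z, A'.
rewrite -eA mulrC divzK //.
elim/hermP: A1 o {eA} => a1 a2 a3 x y z o.
have := o; rewrite herm0 => /(orb_phi 1).
rewrite mulr0 addr0 => o'.
have /orb_cyc := o'; rewrite !jcycE => /dvd_A3.
have /orb_cyc := o; rewrite !jcycE => /dvd_A3.
move=> d d'; have -> : be1 = a1 + 1 * be1 - a1 by ring.
by rewrite rpredB.
Qed.

End Minimal.

(** Take the smallest positive first coordinate m on the orbit. If m did not
    divide the corner b1, one division step, made by an exponential and an
    opposite exponential, would replace m by the remainder. If all first
    coordinates on the orbit vanish, the same argument with m = 0 gives x = 0.
    *)
Lemma reduction (x : MZ) : x != 0 -> exists al be A,
  0 < al /\ same_orbit x (frd al (al * be) (al *: A) 0).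
Proof.
move=> x0.
pose P (m : nat) := asbool ((0 < m)%N /\ exists be A B,
  same_orbit x (frd m%:Z be A B)).
have exP : exists n, P n.
  apply: contrapT => nP.
  have al0 al be A B : same_orbit x (frd al be A B) -> al = 0.
    move=> o; have [//|aln] := eqVneq al 0; case: nP; exists `|al|%N.
    apply/asboolP; split; first by rewrite absz_gt0.
    have [al_ge|al_lt] := leP 0 al; first by exists be, A, B; rewrite gez0_abs.
    exists (- be), (- A), (- B); rewrite ltz0_abs //.
    exact: orb_opp.
  have g0 be A b1 b2 b3 u v w :
      same_orbit x (frd 0 be A (herm b1 b2 b3 u v w)) -> (0 %| b1)%Z.
    elim/hermP: A => ? ? ? ? ? ? o; rewrite dvd0z.
    by have := al0 _ _ _ _ (orb_phi 1 o); rewrite add0r mul1r => ->.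
  have [al [be [A [B ex]]]] : exists al be A B, x = frd al be A B.
    by elim/frdP: x {x0 nP P al0 g0} => al be A B; exists al, be, A, B.
  have o := orbit_refl x; rewrite {2}ex in o.
  have e0 := al0 _ _ _ _ o; rewrite e0 in o ex.
  have [A' eA] := dvd_A g0 o; have [B' eB] := dvd_B g0 o.
  have be0 : be = 0 by have /al0/eqP := orb_J o; rewrite oppr_eq0 => /eqP.
  by case/eqP: x0; rewrite ex eA eB be0 !scale0r frd0.
case: (ex_minnP exP) => m /asboolP[m_gt0 [be [A [B o]]]] min_m.
have gm be' A' b1 b2 b3 u v w :
    same_orbit x (frd m%:Z be' A' (herm b1 b2 b3 u v w)) -> (m%:Z %| b1)%Z.
  elim/hermP: A' => a1 a2 a3 y1 y2 y3 o'.
  (* Shifting b1 to its remainder minus m, then adding it to m, yields the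
     remainder as first coordinate. *)
  set q := (b1 %/ m%:Z)%Z; have eb := divz_eq b1 m%:Z.
  have := orb_phi 1 (orb_psi (- (q + 1)) o').
  have -> : m%:Z + 1 * (b1 + - (q + 1) * m%:Z) = (b1 %% m%:Z)%Z.
    by rewrite {1}eb -/q; ring.
  have := ltz_pmod b1 (d := m%:Z) m_gt0; have m0 : m%:Z != 0 by rewrite -lt0n.
  have := modz_ge0 b1 m0.
  case: (b1 %% m%:Z)%Z eb => [[|r]|r] eb // _ r_lt o2.
  - by rewrite eb addr0 dvdz_mull.
  have := min_m r.+1; rewrite leqNgt -ltz_nat r_lt => H; suff /H : P r.+1 by [].
  by apply/asboolP; split=> //; do 3 eexists; exact: o2.
have [be' [A' o']] := corner_dvd_reduction gm o.
by exists m%:Z, be', A'.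
Qed.

End Orbits.

(** * Rank and divisors along orbits *)

Section Rank.
Variable k : comp_kind.
Local Notation CZ := (comp_alg k int).
Local Notation JZ := (herm3 CZ).
Local Notation MZ := (freudenthal CZ).
Local Notation MQ := (freudenthal (comp_alg k rat)).
Let laws := comp_alg_laws k int.
Let lawsQ := comp_alg_laws k rat.
Implicit Types (al be t : int) (A B D : JZ) (u v : CZ) (x y z w : MZ).

Lemma quartic4_toQ x y z w :
  quartic4 (toQ x) (toQ y) (toQ z) (toQ w) = polar (@qZ k) [tuple x; y; z; w].
Proof. by rewrite /quartic4 !polar4E /qZ !toQ_D toQ_0. Qed.

(** A group element is defined on the lattice only, so the polar form is first
    written with values of q at lattice points. *)
Lemma quartic4_Inv (g : {linear MZ -> MZ}) x y z w : is_Inv g ->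
  quartic4 (toQ (g x)) (toQ (g y)) (toQ (g z)) (toQ (g w)) =
  quartic4 (toQ x) (toQ y) (toQ z) (toQ w).
Proof.
case=> _ qg _; have gD a b : g a + g b = g (a + b) by rewrite raddfD.
have q0 : qZ (0 : MZ) = qZ (g 0) by rewrite raddf0.
by rewrite !quartic4_toQ !polar4E q0 !gD !qg.
Qed.

(** Expressed on the lattice by q and the symplectic form alone, hence
    invariant under the group; the condition of rank at most 1 and the divisor
    d_2 are read off it. *)
Definition rank1_form x y w : rat := symp (rank1_op (toQ x) (toQ y)) (toQ w).

Lemma rank1_formE x y w : rank1_form x y w =
  3 * quartic4 (toQ x) (toQ x) (toQ y) (toQ w) + (symp x y * symp x w)%:~R.
Proof.
have lin (r s : rat) (a b c : MQ) :
    symp (r *: a + s *: b) c = r * symp a c + s * symp b c.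
  elim/frdP: a => *; elim/frdP: b => *; elim/frdP: c => *.
  rewrite !frdZ frdD !sympE !(jtraceDl lawsQ) !(jtraceZl lawsQ).
  by ring.
by rewrite /rank1_form /rank1_op lin symp_triple !toQ_symp rmorphM.
Qed.

Lemma rank1_form_Inv (g : {linear MZ -> MZ}) x y w : is_Inv g ->
  rank1_form (g x) (g y) (g w) = rank1_form x y w.
Proof.
move=> ig; rewrite !rank1_formE quartic4_Inv //.
by case: ig => _ _ sg; rewrite !sg.
Qed.

Definition triple_vanishes x :=
  forall w, quartic4 (toQ x) (toQ x) (toQ x) (toQ w) = 0.

Definition rank1_vanishes x := forall y w, rank1_form x y w = 0.

Lemma triple_vanishesP x :
  triple (toQ x) (toQ x) (toQ x) = 0 <-> triple_vanishes x.
Proof.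
have s0 (m : MQ) : symp 0 m = 0.
  by elim/frdP: m => *; rewrite frd0 sympE !(jtrace0l lawsQ); ring.
split=> [t0 w|v]; first by rewrite -symp_triple t0 s0.
by apply: toQ_nondeg => w; rewrite symp_triple v.
Qed.

Lemma rank1_vanishesP x :
  (forall y, rank1_op (toQ x) (toQ y) = 0) <-> rank1_vanishes x.
Proof.
have s0 (m : MQ) : symp 0 m = 0.
  by elim/frdP: m => *; rewrite frd0 sympE !(jtrace0l lawsQ); ring.
split=> [t0 y w|v y]; first by rewrite /rank1_form t0 s0.
by apply: toQ_nondeg => w; exact: v.
Qed.

Lemma triple_vanishes_orbit x y :
  same_orbit x y -> triple_vanishes x -> triple_vanishes y.
Proof.
move=> [g [ig <-]] v w; have [[g' gK g'K] _ _] := ig.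
by rewrite -(g'K w) quartic4_Inv.
Qed.

Lemma rank1_vanishes_orbit x y :
  same_orbit x y -> rank1_vanishes x -> rank1_vanishes y.
Proof.
move=> [g [ig <-]] v z w; have [[g' gK g'K] _ _] := ig.
by rewrite -(g'K w) -(g'K z) rank1_form_Inv.
Qed.

Lemma symp_inj x y : (forall w, symp x w = symp y w) -> x = y.
Proof.
elim/frdP: x => al be A B; elim/frdP: y => al' be' A' B' H.
have T ga de D E : al * de - be * ga + jtrace A E - jtrace B D =
    al' * de - be' * ga + jtrace A' E - jtrace B' D.
  by have := H (frd ga de D E); rewrite !sympE.
congr frd; try (apply: (jtrace_inj laws) => D).
- by have := T 0 1 0 0; rewrite !(jtrace0r laws) => /eq_by_diff; apply; ring.
- by have := T (-1) 0 0 0; rewrite !(jtrace0r laws) => /eq_by_diff; apply; ring.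
- by have := T 0 0 0 D; rewrite !(jtrace0r laws) => /eq_by_diff; apply; ring.
have /esym := T 0 0 D 0; rewrite !(jtrace0r laws) => /eq_by_diff; apply.
by ring.
Qed.

Lemma toQ_inj : injective (@toQ k).
Proof.
move=> x y e; apply: symp_inj => w; apply: (@intr_inj rat).
by rewrite -!toQ_symp e.
Qed.

Lemma is_d1P x d : is_d1 x d <-> (exists x', x = d *: x') /\
  (forall e : int, (exists x', x = e *: x') -> e <= d).
Proof.
have dvdE e : (forall m, [set toQ x]%classic m -> divides e m) <->
    exists x', x = e *: x'.
  split=> [H|[x' ->] m ->]; last by exists x'.
  by have [x' /toQ_inj e1] := H _ erefl; exists x'.
split=> -[H1 H2]; split; first by apply/dvdE.
- by move=> c Hc; apply: H2; apply/dvdE.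
- by apply/dvdE.
by move=> c Hc; apply: H2; apply/dvdE.
Qed.

Lemma is_d2P x d : is_d2 x d <->
  (forall y w, exists e : int, rank1_form x y w = (d * e)%:~R) /\
  (forall c : int,
    (forall y w, exists e : int, rank1_form x y w = (c * e)%:~R) -> c <= d).
Proof.
have dvdE c : (forall m,
    [set rank1_op (toQ x) (toQ y) | y in [set: MZ]]%classic m -> divides c m)
  <->
    forall y w, exists e : int, rank1_form x y w = (c * e)%:~R.
  split=> [H y|H m [y _ <-]]; first by apply/divides_symp; apply: H; exists y.
  by apply/divides_symp; exact: H.
split=> -[H1 H2]; split; first by apply/dvdE.
- by move=> c Hc; apply: H2; apply/dvdE.
- by apply/dvdE.
by move=> c Hc; apply: H2; apply/dvdE.
Qed.

Lemma is_d1_orbit x y d : same_orbit x y -> is_d1 x d -> is_d1 y d.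
Proof.
move=> [g [[[g' gK g'K] _ _] <-]] /is_d1P[[x' ex] max]; apply/is_d1P; split.
  by exists (g x'); rewrite {1}ex linearZ.
move=> e [z ez]; apply: max; exists (g' z).
have lg' := can2_linear gK g'K.
by rewrite -(gK x) ez -[X in g' X]addr0 lg' -[g' 0]/(g' 0) -(raddf0 g) gK addr0.
Qed.

Lemma is_d2_orbit x y d : same_orbit x y -> is_d2 x d -> is_d2 y d.
Proof.
move=> [g [ig <-]] /is_d2P[H max]; have [[g' gK g'K] _ _] := ig.
apply/is_d2P; split=> [z w|c Hc].
  by rewrite -(g'K z) -(g'K w) rank1_form_Inv.
by apply: max => z w; rewrite -(rank1_form_Inv _ _ _ ig).
Qed.

Lemma is_gcd_uniq (S : set MQ) d e : is_gcd S d -> is_gcd S e -> d = e.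
Proof.
move=> [d1 d2] [e1 e2]; apply/eqP; rewrite eq_le.
by rewrite e2 // d2.
Qed.

Section Reduced.
Variables (al : int).

Lemma herm3_toQ_cross A B :
  jcross (herm3_toQ A) (herm3_toQ B) = herm3_toQ (jcross A B).
Proof.
have := jsharpD lawsQ (herm3_toQ A) (herm3_toQ B).
rewrite -herm3_toQ_D -!herm3_toQ_sharp (jsharpD laws) !herm3_toQ_D.
by move/addrI => ->.
Qed.

Lemma quartic4_reduced be A ga de B D :
  quartic4 (toQ (frd al be A 0)) (toQ (frd al be A 0)) (toQ (frd al be A 0))
    (toQ (frd ga de B D)) =
  (- 2 * al * jtrace (jsharp A) B - 2 * ga * cubic A
    + al * be * (jtrace A D - al * de - be * ga))%:~R.
Proof.
rewrite !toQE quartic4E /full_quart herm3_toQ_0.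
rewrite ?(jcross0l lawsQ) ?(jcross0r lawsQ) ?(jtrace0l lawsQ) ?(jtrace0r lawsQ).
rewrite (jtraceC _ (jcross (herm3_toQ A) (herm3_toQ B))).
rewrite (jcrossC lawsQ _ (herm3_toQ B)) (jtrace_cross_cyc lawsQ (herm3_toQ B)).
rewrite (jcrossxx lawsQ) (jtraceZl lawsQ).
rewrite (jtraceC (herm3_toQ A)) (jtraceZl lawsQ) (jtrace_sharp lawsQ).
rewrite -herm3_toQ_sharp herm3_toQ_cubic !herm3_toQ_jtrace.
rewrite !(rmorphD, rmorphB, rmorphN, rmorphM) /=.
by field.
Qed.

Lemma rank1_form_reduced A ga de B D ga' de' B' D' : jsharp A = 0 ->
  rank1_form (frd al 0 A 0) (frd ga de B D) (frd ga' de' B' D') =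
  (- 2 * al * jtrace A (jcross B B')
   + 2 * (al * de * jtrace A D' + al * de' * jtrace A D))%:~R.
Proof.
move=> A0; rewrite rank1_formE !sympE !(jtrace0l laws) !toQE quartic4E.
rewrite /full_quart.
have A0' : jsharp (herm3_toQ A) = 0 by rewrite -herm3_toQ_sharp A0 herm3_toQ_0.
have cr (B1 : herm3 (comp_alg k rat)) :
    jtrace (herm3_toQ A) (jcross (herm3_toQ A) B1) = 0.
  rewrite jtraceC (jcrossC lawsQ) (jtrace_cross_cyc lawsQ) (jcrossxx lawsQ).
  by rewrite A0' scaler0 (jtrace0l lawsQ).
rewrite herm3_toQ_0.
rewrite !cr.
rewrite ?(jcross0l lawsQ) ?(jcross0r lawsQ) ?(jtrace0l lawsQ) ?(jtrace0r lawsQ).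
rewrite (jcrossxx lawsQ) A0' scaler0 (jtrace0l lawsQ).
rewrite !herm3_toQ_cross !herm3_toQ_jtrace.
by rewrite !(rmorphD, rmorphB, rmorphN, rmorphM) /=; field.
Qed.

End Reduced.

Lemma quart_reduced al A : jsharp A = 0 -> quart (frd al 0 A 0) = 0.
Proof.
move=> A0; have := jtrace_sharp laws A; rewrite A0 (jtrace0l laws) => /esym/eqP.
rewrite mulf_eq0 /= => /eqP cA.
by rewrite quartE A0 (jtrace0l laws) (jtrace0r laws) cA; ring.
Qed.

Lemma triple_vanishes_reduced al A :
  jsharp A = 0 -> triple_vanishes (frd al 0 A 0).
Proof.
move=> A0; have := jtrace_sharp laws A; rewrite A0 (jtrace0l laws) => /esym/eqP.
rewrite mulf_eq0 /= => /eqP cA.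
elim/frdP=> ga de B D; rewrite quartic4_reduced A0 (jtrace0l laws) cA.
by rewrite -[RHS]/(0%:~R : rat); congr (_%:~R); ring.
Qed.

(** Testing against w = (0,1,0,0) gives al^2 be = 0, testing against w =
    (0,0,B,0) gives al (A^#, B) = 0. *)
Lemma triple_vanishes_inv al be A : 0 < al ->
  triple_vanishes (frd al be A 0) -> be = 0 /\ jsharp A = 0.
Proof.
move=> al_gt0 v; have al0 : al != 0 by rewrite gt_eqF.
have b0 : be = 0.
  have := v (frd 0 1 0 0); rewrite quartic4_reduced !(jtrace0r laws).
  move=> /(@intr_inj rat _ 0) /eqP.
  have -> : -2 * al * 0 - 2 * 0 * cubic A + al * be * (0 - al * 1 - be * 0) =
    - (al * al * be) by ring.
  by rewrite oppr_eq0 !mulf_eq0 (negPf al0) => /eqP.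
split=> //; apply: (jtrace_inj laws) => B; rewrite (jtrace0l laws).
have := v (frd 0 0 B 0); rewrite quartic4_reduced b0 !(jtrace0r laws).
move=> /(@intr_inj rat _ 0) /eqP.
have -> : -2 * al * jtrace (jsharp A) B - 2 * 0 * cubic A +
  al * 0 * (0 - al * 0 - 0 * 0) = - 2 * al * jtrace (jsharp A) B by ring.
by rewrite !mulf_eq0 (negPf al0) => /eqP.
Qed.

(** Test against y = (0,0,0,D) and w = (0,1,0,0). *)
Lemma rank1_vanishes_inv al A : 0 < al -> jsharp A = 0 ->
  rank1_vanishes (frd al 0 A 0) -> A = 0.
Proof.
move=> al_gt0 A0 v; have al0 : al != 0 by rewrite gt_eqF.
apply: (jtrace_inj laws) => D; rewrite (jtrace0l laws).
have := v (frd 0 0 0 D) (frd 0 1 0 0); rewrite rank1_form_reduced //.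
rewrite !(jtrace0r laws) (jcross0r laws) (jtrace0r laws).
move=> /(@intr_inj rat _ 0) /eqP.
have -> : -2 * al * 0 + 2 * (al * 0 * 0 + al * 1 * jtrace A D) =
  2 * al * jtrace A D by ring.
by rewrite !mulf_eq0 (negPf al0) => /eqP.
Qed.

Lemma rank1_vanishes_reduced al : rank1_vanishes (frd al 0 0 0).
Proof.
elim/frdP=> ga de B D; elim/frdP=> ga' de' B' D'.
rewrite rank1_form_reduced ?(jsharp0 laws) // !(jtrace0l laws).
by rewrite -[RHS]/(0%:~R : rat); congr (_%:~R); ring.
Qed.

Lemma has_rank1 x : has_rank x 1 <->
  [/\ x <> 0, qZ x = 0, triple_vanishes x & rank1_vanishes x].
Proof.
split=> [[_ [_ H3 H2 H1 H0]]|[x0 q0 t0 r0]].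
  split; [by move/H0|exact/H3|exact/triple_vanishesP/H2|].
  by apply/rank1_vanishesP/H1.
split=> //; split; split=> //.
- by move=> _; exact/triple_vanishesP.
- by move=> _; exact/rank1_vanishesP.
Qed.

Lemma has_rank2 x : has_rank x 2 <->
  [/\ x <> 0, qZ x = 0, triple_vanishes x & ~ rank1_vanishes x].
Proof.
split=> [[_ [_ H3 H2 H1 H0]]|[x0 q0 t0 r0]].
  split; [by move/H0|exact/H3|exact/triple_vanishesP/H2|].
  by move/rank1_vanishesP/H1.
split=> //; split; split=> //.
- by move=> _; exact/triple_vanishesP.
- by move/rank1_vanishesP.
Qed.

Lemma reduction_rank2 x : x <> 0 -> triple_vanishes x -> exists al A,
  [/\ 0 < al, jsharp (al *: A) = 0 & same_orbit x (frd al 0 (al *: A) 0)].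
Proof.
move=> /eqP x0 tx; have [al [be [A [al_gt0 o]]]] := reduction x0.
have [b0 sA] := triple_vanishes_inv al_gt0 (triple_vanishes_orbit o tx).
by exists al, A; split=> //; rewrite -b0.
Qed.

Lemma frd_neq0 al be A B : 0 < al -> frd al be A B <> (0 : MZ).
Proof.
by move=> al_gt0; rewrite frd0 => /frd_inj[al0]; rewrite al0 in al_gt0.
Qed.

Lemma qZ_reduced al A : jsharp A = 0 -> qZ (frd al 0 A 0) = 0.
Proof. by move=> A0; rewrite qZE quart_reduced. Qed.

Lemma has_rank1_reduced al : 0 < al -> has_rank (frd al 0 0 0 : MZ) 1.
Proof.
move=> al_gt0; apply/has_rank1; have s0 := jsharp0 laws.
split; [exact: frd_neq0|exact: qZ_reduced|exact: triple_vanishes_reduced|].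
exact: rank1_vanishes_reduced.
Qed.

Lemma has_rank2_reduced al A : 0 < al -> jsharp A = 0 -> A != 0 ->
  has_rank (frd al 0 A 0 : MZ) 2.
Proof.
move=> al_gt0 A0 /eqP An0; apply/has_rank2.
split; [exact: frd_neq0|exact: qZ_reduced|exact: triple_vanishes_reduced|].
by move/(rank1_vanishes_inv al_gt0 A0).
Qed.

Lemma le_divisor (c e : int) : 0 < c * e -> c <= c * e.
Proof.
move=> ce; have [c0|c0] := leP c 0; first exact: le_trans c0 (ltW ce).
by rewrite pmulr_rgt0 // in ce; rewrite ler_peMr ?(ltW c0).
Qed.

Lemma is_d1_reduced al A : 0 < al -> is_d1 (frd al 0 (al *: A) 0) al.
Proof.
move=> al_gt0; apply/is_d1P; split.
  by exists (frd 1 0 A 0); rewrite frdZ mulr1 mulr0 scaler0.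
move=> e [x']; elim/frdP: x' => c d B D; rewrite frdZ => /frd_inj[ec _ _ _].
by move: al_gt0; rewrite ec => /le_divisor.
Qed.

Lemma jsharp_diag1 (m : int) : jsharp (herm m 0 0 0 0 0) = 0 :> JZ.
Proof.
rewrite jsharpE (norm0 laws) !(para0l laws) !mul0r !mulr0 !subr0 !scaler0.
by rewrite ![in herm _ _ _ _ _ _]subr0 herm0.
Qed.

(** All values are multiples of 2 al m, and 2 al m is attained at y =
    (0,1,0,0) and w = (0,0,0,diag(1,0,0)). *)
Lemma is_d2_reduced al (m : int) : 0 < al -> 0 < m ->
  is_d2 (frd al 0 (herm m 0 0 0 0 0) 0 : MZ) (2 * al * m).
Proof.
move=> al_gt0 m_gt0.
have trm B : exists c, jtrace (herm m 0 0 0 0 0) B = m * c.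
  elim/hermP: B => a *; exists a; rewrite jtraceE !(bil0l laws).
  by ring.
apply/is_d2P; split.
  elim/frdP=> ga de B D; elim/frdP=> ga' de' B' D'.
  rewrite (rank1_form_reduced al _ _ _ _ _ _ _ _ (jsharp_diag1 m)).
  have [c1 ->] := trm (jcross B B'); have [c2 ->] := trm D.
  have [c3 ->] := trm D'; exists (- c1 + de * c3 + de' * c2).
  by congr (_%:~R); ring.
move=> c /(_ (frd 0 1 0 0) (frd 0 0 0 (herm 1 0 0 0 0 0)))[e].
rewrite (rank1_form_reduced al _ _ _ _ _ _ _ _ (jsharp_diag1 m)) => /intr_inj.
rewrite (jcross0l laws) !(jtrace0r laws) jtraceE !(bil0l laws).
move=> H; have {}H : 2 * al * m = c * e by rewrite -H; ring.
have : 0 < 2 * al * m by rewrite !mulr_gt0.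
by rewrite H => /le_divisor.
Qed.

End Rank.

(** * Elements of rank two *)

Lemma neg_parabola (a b m : int) : b < 0 ->
  exists s : int, 0 < a + s * m - b * s ^+ 2.
Proof.
(* This s exceeds |a| + |m|, so that b s^2 outweighs the other terms. *)
move=> b_lt0; exists (`|a| + `|m| + 1).
have a_ge : 0 <= a + `|a| by have := ler_norm (- a); rewrite normrN; lia.
have m_ge : 0 <= m + `|m| by have := ler_norm (- m); rewrite normrN; lia.
move: (`|a|) (`|m|) (normr_ge0 a) (normr_ge0 m) a_ge m_ge => c d c0 d0 ca dm.
have h1 : 0 <= (c + d + 1) * (m + d) by rewrite mulr_ge0 //; lia.
have h2 : 0 <= (c + d + 1) ^+ 2 * (- b - 1).
  by rewrite mulr_ge0 ?sqr_ge0 //; lia.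
have h3 : 0 <= (c + d) * (c + 1) by rewrite mulr_ge0 //; lia.
have -> : a + (c + d + 1) * m - b * (c + d + 1) ^+ 2 =
  (a + c) + (c + d + 1) * (m + d) + (c + d + 1) ^+ 2 * (- b - 1)
  + (c + d) * (c + 1) + 1.
  by ring.
by lia.
Qed.

Section RankTwo.
Variable k : comp_kind.
Local Notation CZ := (comp_alg k int).
Local Notation JZ := (herm3 CZ).
Local Notation MZ := (freudenthal CZ).
Let laws := comp_alg_laws k int.
Local Notation linE := (linE laws).
Implicit Types (al be t : int) (A B D : JZ) (u v w : CZ).

Lemma elem21_0 u : elem21 u (0 : JZ) = 0.
Proof.
by rewrite herm0 elem21E (bil0l laws) (para0l laws) mul0r scale0r !addr0.
Qed.

Lemma elem12_0 u : elem12 u (0 : JZ) = 0.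
Proof.
by rewrite herm0 elem12E (bil0l laws) (para0r laws) mul0r scale0r !addr0.
Qed.

Lemma jcyc0 : jcyc (0 : JZ) = 0.
Proof. by rewrite herm0 jcycE. Qed.

Section Orbit.
Variable x0 : MZ.
Local Notation O := (same_orbit x0).

Lemma orbA_cyc al be A : O (frd al be A 0) -> O (frd al be (jcyc A) 0).
Proof. by move/orb_cyc; rewrite jcyc0. Qed.

Lemma orbA_elem12 u al be A : O (frd al be A 0) -> O (frd al be (elem12 u A) 0).
Proof. by move/(orb_elem12 u); rewrite elem21_0. Qed.

Lemma orbA_elem21 u al be A : O (frd al be A 0) -> O (frd al be (elem21 u A) 0).
Proof. by move/(orb_elem21 u); rewrite elem12_0. Qed.

Lemma hyp_pair : exists e f : CZ,
  [/\ c_norm e = 0, c_norm f = 0, c_bil e f = 1 & c_bil f e = 1].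
Proof.
have := hyp_neq0 laws; have := hyp_isotropic laws.
case: (hyp_basis k int) => // p s /(_ p (mem_head p s))[e f ef] _.
by exists p.1, p.2; rewrite (bilC p.2).
Qed.

Variable al : int.
Hypothesis sharp0 : forall A, O (frd al 0 A 0) -> jsharp A = 0.

(** If some corner entry is negative, adding to z a large multiple of a vector
    of norm -1 makes the next diagonal entry positive, which is possible
    because the norm form is indefinite. If all diagonal entries vanish on the
    orbit, so do the off-diagonal ones. *)
Lemma pos_corner A : O (frd al 0 A 0) -> A != 0 ->
  exists a1 a2 a3 x y z, 0 < a1 /\ O (frd al 0 (herm a1 a2 a3 x y z) 0).
Proof.
move=> o /eqP An0; apply: contrapT => nP.
have neg a1 a2 a3 x y z : O (frd al 0 (herm a1 a2 a3 x y z) 0) -> a1 = 0.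
  move=> o1; apply/eqP; rewrite eq_le; apply/andP; split.
    rewrite leNgt; apply/negP => a1_gt0; apply: nP.
    by exists a1, a2, a3, x, y, z.
  rewrite leNgt; apply/negP => a1_lt0.
  have [e [f [ne nf ef fe]]] := hyp_pair.
  (* The vector e - f has norm -1. *)
  have [s s_gt0] := neg_parabola a2 (c_bil z (e - f)) a1_lt0.
  have := orbA_cyc (orbA_elem21 (s *: (e - f)) o1).
  rewrite elem21E jcycE => o2; apply: nP; do 6 eexists; split; last exact: o2.
  rewrite !linE in s_gt0 *; rewrite ne nf ef.
  by move: s_gt0; congr (_ < _); ring.
have off a1 a2 a3 x y z : O (frd al 0 (herm a1 a2 a3 x y z) 0) -> z = 0.
  move=> o1; apply: (bil_inj laws) => u; rewrite (bil0l laws).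
  have := orbA_cyc o1; rewrite jcycE => /neg a20.
  have := orbA_elem12 u o1; rewrite elem12E a20 => /neg.
  rewrite (neg _ _ _ _ _ _ o1).
  by move/eq_by_diff; apply; ring.
apply: An0; elim/hermP: A o => a1 a2 a3 x y z o1.
have := orbA_cyc o1; rewrite jcycE => o2.
have := orbA_cyc o2; rewrite jcycE => o3.
rewrite (neg _ _ _ _ _ _ o1) (neg _ _ _ _ _ _ o2) (neg _ _ _ _ _ _ o3).
by rewrite (off _ _ _ _ _ _ o1) (off _ _ _ _ _ _ o2) (off _ _ _ _ _ _ o3) herm0.
Qed.

(** Minimality again: an isotropic vector u and its dual partner turn the
    smallest positive corner entry m into the remainder of n(z, u) modulo m.
    Hence m divides y and z, these can be cleared, and A^# = 0 annihilates the
    rest. *)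
Lemma rank_two_diag A : O (frd al 0 A 0) -> A != 0 ->
  exists a, 0 < a /\ O (frd al 0 (herm a 0 0 0 0 0) 0).
Proof.
move=> o An0.
pose P (m : nat) := asbool ((0 < m)%N /\ exists a2 a3 x y z,
  O (frd al 0 (herm m%:Z a2 a3 x y z) 0)).
have exP : exists m, P m.
  have [a1 [a2 [a3 [x [y [z [a1_gt0 o1]]]]]]] := pos_corner o An0.
  exists `|a1|%N; apply/asboolP; split; first by rewrite absz_gt0 gt_eqF.
  by exists a2, a3, x, y, z; rewrite gtz0_abs.
case: (ex_minnP exP) => m /asboolP[m_gt0 [a2 [a3 [x [y [z o1]]]]]] min_m.
have min_mod b : (exists a2 a3 x y z, O (frd al 0
    (herm (b %% m%:Z)%Z a2 a3 x y z) 0)) -> (m%:Z %| b)%Z.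
  have m0 : m%:Z != 0 by rewrite -lt0n.
  have := ltz_pmod b (d := m%:Z) m_gt0; have := modz_ge0 b m0.
  rewrite (sameP dvdz_mod0P eqP).
  case: (b %% m%:Z)%Z => [[|r]|r] // _ r_lt o2.
  have := min_m r.+1; rewrite leqNgt -ltz_nat r_lt => H; suff /H : P r.+1 by [].
  by apply/asboolP.
have [z' ez] : exists z', z = m%:Z *: z'.
  apply: dvd_comp => p hp; have [e0 f0 ef] := hyp_isotropic laws hp.
  apply: min_mod; set b := c_bil z p.2.
  have := orbA_elem12 p.2 (orbA_elem21 (- ((b %/ m%:Z)%Z + 1) *: p.1) o1).
  rewrite elem21E elem12E !linE ef f0.
  have -> : m%:Z + (c_bil z p.2 + m%:Z * (- ((b %/ m%:Z)%Z + 1) * 1)) +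
     (a2 + - ((b %/ m%:Z)%Z + 1) * c_bil z p.1 +
        m%:Z * ((- ((b %/ m%:Z)%Z + 1)) ^+ 2 * c_norm p.1)) * 0 = (b %% m%:Z)%Z.
    by rewrite -/b {1}(divz_eq b m%:Z); ring.
  by move=> o2; do 5 eexists; exact: o2.
have [b2 [x1 o2]] :
    exists b2 x1, O (frd al 0 (herm m%:Z b2 a3 x1 y 0) 0).
  have := orbA_elem21 (- z') o1; rewrite elem21E ez scalerN subrr => o2.
  by do 2 eexists; exact: o2.
have := orbA_cyc (orbA_cyc o2); rewrite !jcycE => o3.
have [y' ey] : exists y', y = m%:Z *: y'.
  apply: dvd_comp => p hp; have [e0 f0 ef] := hyp_isotropic laws hp.
  apply: min_mod; set b := c_bil y p.2.
  have := orbA_cyc (orbA_elem21 p.2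
    (orbA_elem12 (- ((b %/ m%:Z)%Z + 1) *: p.1) o3)).
  rewrite elem12E elem21E jcycE !linE ef f0 !mulr0 !addr0 mulr1.
  have -> : m%:Z + (c_bil y p.2 + m%:Z * (- ((b %/ m%:Z)%Z + 1))) =
      (b %% m%:Z)%Z.
    by rewrite -/b {1}(divz_eq b m%:Z); ring.
  by move=> o4; do 5 eexists; exact: o4.
have [b3 [x2 o4]] : exists b3 x2, O (frd al 0 (herm m%:Z b2 b3 x2 0 0) 0).
  have := orbA_cyc (orbA_elem12 (- y') o3).
  rewrite elem12E jcycE ey scalerN subrr => o4.
  by do 2 eexists; exact: o4.
have m0 : m%:Z != 0 by rewrite -lt0n.
have := sharp0 o4; rewrite jsharpE [X in _ = X -> _]herm0.
rewrite !(norm0 laws) !(para0l laws) (para0r laws).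
rewrite !subr0 => /herm_inj[_ b3E b2E [xE _ _]].
exists m%:Z; split=> //.
have -> : herm m%:Z 0 0 0 0 0 = herm m%:Z b2 b3 x2 0 0 :> JZ.
  congr herm; first by move/eqP: b2E; rewrite mulf_eq0 (negPf m0) => /eqP.
    by move/eqP: b3E; rewrite mulf_eq0 (negPf m0) => /eqP.
  apply: (bil_inj laws) => w; rewrite (bil0l laws).
  have /eqP := congr1 (fun u => c_bil u w) xE.
  by rewrite !linE sub0r oppr_eq0 mulf_eq0 (negPf m0) => /eqP.
exact: o4.
Qed.

End Orbit.
End RankTwo.

(** * Projective elements *)

Section Projective.
Variable k : comp_kind.
Local Notation CZ := (comp_alg k int).
Local Notation JZ := (herm3 CZ).
Local Notation MZ := (freudenthal CZ).
Let laws := comp_alg_laws k int.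
Local Notation linE := (linE laws).
Implicit Types (be t : int) (A B D : JZ) (u v w : CZ).

Definition dia be (a b c : int) : MZ := frd 1 be (herm a b c 0 0 0) 0.

Variable x0 : MZ.
Local Notation O := (same_orbit x0).

Lemma dia_cyc be a b c : O (dia be a b c) -> O (dia be b c a).
Proof. by move/orbA_cyc; rewrite jcycE. Qed.

(** The entry a, the coefficient be and - b c are the coefficients of a binary
    quadratic form of discriminant q'; the map is the substitution of the
    unipotent matrix with entry t. *)
Lemma dia_translate t be a b c : O (dia be a b c) ->
  O (dia (be - 2 * t * b * c) (a + t * be - t ^+ 2 * b * c) b c).
Proof.
rewrite /dia; rewrite {1}herm0 => /(orb_phi t) /orb_cyc.
rewrite !jcycE => /(orb_psi (- (t * c))) /orb_cyc.
rewrite !jcycE => /(orb_psi (- (t * b))) /orb_cyc.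
rewrite !jcycE !(scaler0, subr0, mulr0, addr0, add0r, mulr1, subrr).
rewrite !oppr0 -herm0; congr (O (frd _ _ (herm _ _ _ _ _ _) _)); ring.
Qed.

(** On a pair of hyperbolic coordinates of z, the elementary maps act as row
    and column operations on the 2 x 2 matrix with diagonal a, b and
    antidiagonal these coordinates; the steps below bring diag(a, b) to its
    Smith form. *)
Lemma dia_gcd be (a b c g a' b' r s : int) :
  a = g * a' -> b = g * b' -> r * a + s * b = g ->
  O (dia be a b c) -> O (dia be g (a' * b) c).
Proof.
move=> ea eb eg.
have [e [f [ne nf ef fe]]] := hyp_pair k.
pose blk p q a1 b1 : JZ := herm a1 b1 c 0 0 (p *: e + q *: f).
have rowp t p q a1 b1 : O (frd 1 be (blk p q a1 b1) 0) ->
    O (frd 1 be (blk (p + t * b1) q (a1 + t * q) b1) 0).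
  move/(orbA_elem12 (t *: e)); rewrite elem12E !linE (bilxx laws) ne fe.
  congr (O (frd _ _ (herm _ _ _ _ _ _) _)).
  - by ring.
  - by rewrite scaler0 addr0.
  by rewrite scalerDl scalerA [b1 * t]mulrC addrAC.
have colp t p q a1 b1 : O (frd 1 be (blk p q a1 b1) 0) ->
    O (frd 1 be (blk p (q + t * b1) (a1 + t * p) b1) 0).
  move/(orbA_elem12 (t *: f)); rewrite elem12E !linE (bilxx laws) nf ef.
  congr (O (frd _ _ (herm _ _ _ _ _ _) _)).
  - by ring.
  - by rewrite scaler0 addr0.
  by rewrite scalerDl scalerA [b1 * t]mulrC addrA.
have colm t p q a1 b1 : O (frd 1 be (blk p q a1 b1) 0) ->
    O (frd 1 be (blk (p + t * a1) q a1 (b1 + t * q)) 0).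
  move/(orbA_elem21 (t *: e)); rewrite elem21E !linE (bilxx laws) ne fe.
  congr (O (frd _ _ (herm _ _ _ _ _ _) _)).
  - by ring.
  - by rewrite scaler0 addr0.
  by rewrite scalerDl scalerA [a1 * t]mulrC addrAC.
have rowm t p q a1 b1 : O (frd 1 be (blk p q a1 b1) 0) ->
    O (frd 1 be (blk p (q + t * a1) a1 (b1 + t * p)) 0).
  move/(orbA_elem21 (t *: f)); rewrite elem21E !linE (bilxx laws) nf ef.
  congr (O (frd _ _ (herm _ _ _ _ _ _) _)).
  - by ring.
  - by rewrite scaler0 addr0.
  by rewrite scalerDl scalerA [a1 * t]mulrC addrA.
have blk0 a1 b1 : blk 0 0 a1 b1 = herm a1 b1 c 0 0 0.
  by rewrite /blk !scale0r addr0.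
rewrite /dia -!blk0.
move/(rowp s)/(colm r)/(colp (- a'))/(rowm (- b'))/(colp 1)/(colm (-1)).
move/(rowm (a' * b')).
have E : 0 + s * b + r * (a + s * 0) = g by rewrite -eg; ring.
rewrite !E; congr (O (frd _ _ (blk _ _ _ _) _)); rewrite ?ea ?eb; ring.
Qed.

(** If be is invertible modulo b, a translation of a third entry makes that
    entry 1 modulo b, hence coprime to b, and [dia_gcd] turns the two into 1
    and their product. The second relation makes be invertible modulo
    gcd(b, c), which produces the first entry 1; the two relations together then
    give the invertibility needed for the second one. *)
Lemma dia_projective be a b c r s t r' s' t' :
  r * a + s * be + t * (b * c) = 1 -> r' * b + s' * be + t' * (a * c) = 1 ->
  O (dia be a b c) -> exists be' m, O (dia be' 1 1 m).
Proof.
move=> h1 h2 o.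
have [u [v eg]] := Bezoutz b c.
have /dvdzP[b' eb] := dvdz_gcdl b c; have /dvdzP[c' ec] := dvdz_gcdr b c.
move: (gcdz b c) eg eb ec => g eg eb ec.
rewrite mulrC in eb; rewrite mulrC in ec.
(* Replace (b, c) by g = gcd(b, c) and l = bc/g. *)
have := dia_gcd eb ec eg (dia_cyc o).
set l := b' * c => /dia_cyc /dia_cyc o1.
have gl : g * l = b * c by rewrite /l eb; ring.
(* As s' inverts be modulo g, this translation makes a equal to 1 modulo g. *)
pose z := s' * (1 - a); pose a1 := a + z * be - z ^+ 2 * g * l.
pose be1 := be - 2 * z * g * l.
have o2 : O (dia be1 a1 g l) by exact: dia_translate.
pose y := r' * b' + t' * a * c'.
have h3 : s' * be + g * y = 1 by rewrite -h2 /y eb ec; ring.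
pose e := (a - 1) * y - z ^+ 2 * l.
have ea1 : a1 = 1 + g * e.
  rewrite /a1 /e /z.
  have -> : g * ((a - 1) * y - (s' * (1 - a)) ^+ 2 * l) =
    (a - 1) * (g * y) - (s' * (1 - a)) ^+ 2 * g * l by ring.
  have -> : g * y = 1 - s' * be by rewrite -h3; ring.
  by ring.
have o3 : O (dia be1 1 (a1 * g) l).
  apply: (@dia_gcd be1 a1 g l 1 a1 g 1 (- e)) o2; rewrite ?mul1r //.
  by rewrite ea1; ring.
have [u1 [v1 eh]] := Bezoutz (a1 * g) l.
have /dvdzP[m1 em1] := dvdz_gcdl (a1 * g) l.
have /dvdzP[m2 em2] := dvdz_gcdr (a1 * g) l.
move: (gcdz (a1 * g) l) eh em1 em2 => h eh em1 em2.
rewrite (mulrC m1) in em1; rewrite (mulrC m2) in em2.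
have := dia_gcd em1 em2 eh (dia_cyc o3).
set kk := m1 * l => /dia_cyc /dia_cyc o4.
pose y2 := y + 2 * s' * z * l.
have h4 : s' * be1 + g * y2 = 1 by rewrite -h3 /be1 /y2; ring.
pose s2 := s - r * z; pose t2 := t + r * z ^+ 2 + 2 * s2 * z.
have h5 : r * a1 + s2 * be1 + t2 * (g * l) = 1.
  by rewrite -h1 -gl /a1 /be1 /t2 /s2; ring.
(* The product of h5 and h4, whose terms free of be1 are divisible by h. *)
pose S := r * a1 * s' + s2 * (s' * be1 + g * y2) + t2 * g * l * s'.
pose W := r * m1 * y2 + t2 * g * g * y2 * m2.
have h6 : S * be1 + h * W = 1.
  rewrite -[RHS]mulr1 -{1}h5 -h4 /S /W.
  have -> : h * (r * m1 * y2 + t2 * g * g * y2 * m2) =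
    r * y2 * (h * m1) + t2 * g * g * y2 * (h * m2) by ring.
  by rewrite -em1 -em2; ring.
(* S inverts be1 modulo h, so that the translated entry is 1 modulo h. *)
pose c1 := S * (1 - kk); pose k1 := kk + c1 * be1 - c1 ^+ 2 * 1 * h.
have o5 : O (dia (be1 - 2 * c1 * 1 * h) 1 h k1).
  by apply: dia_cyc; apply: dia_translate; exact: dia_cyc (dia_cyc o4).
pose E := (kk - 1) * W - c1 ^+ 2.
have ek1 : k1 = 1 + h * E.
  rewrite /k1 /E.
  have -> : h * ((kk - 1) * W - c1 ^+ 2) = (kk - 1) * (h * W) - c1 ^+ 2 * h.
    by ring.
  have -> : h * W = 1 - S * be1 by rewrite -h6; ring.
  by rewrite /c1; ring.
have := @dia_gcd _ h k1 1 1 h k1 (- E) 1 _ _ _ (dia_cyc o5).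
rewrite ?mul1r => /(_ erefl erefl) H.
do 2 eexists; apply: dia_cyc; apply: dia_cyc; apply: H.
by rewrite ek1; ring.
Qed.

Lemma dia_normal be m : O (dia be 1 1 m) ->
  exists eps m', (eps = 0 \/ eps = 1) /\ O (dia eps 1 1 m').
Proof.
move=> /dia_cyc /dia_cyc /(dia_translate (be %/ 2)%Z) /dia_cyc.
have -> : be - 2 * (be %/ 2)%Z * 1 * 1 = (be %% 2)%Z.
  by rewrite {1}(divz_eq be 2); ring.
move=> o; exists (be %% 2)%Z; eexists; split; last exact: o.
have := modz_ge0 be (isT : (2 : int) != 0).
have := ltz_pmod be (isT : 0 < (2 : int)).
by lia.
Qed.

Lemma quart_dia be a b c :
  quart (dia be a b c) = - 8 * (a * b * c) - 2 * be ^+ 2.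
Proof.
rewrite /dia quartE (jsharp0 laws) (cubic0 laws) !(jtrace0r laws).
rewrite (cubic_herm laws).
rewrite !(norm0 laws) (bil0r laws).
by ring.
Qed.

End Projective.

(** * The orbit classification *)

Section Classification.
Variable k : comp_kind.
Local Notation CZ := (comp_alg k int).
Local Notation JZ := (herm3 CZ).
Local Notation MZ := (freudenthal CZ).
Let laws := comp_alg_laws k int.
Implicit Types x : MZ.

Lemma melt_frd (m : int) : melt m 0 0 0 = frd m 0 0 0 :> MZ.
Proof. by rewrite frd_melt. Qed.

Lemma mdiag_frd (al be a b c : int) :
  mdiag k al be a b c = frd al be (herm a b c 0 0 0) 0.
Proof. by rewrite frd_melt herm_tuple. Qed.

Lemma is_d1_corner (m : int) : 1 <= m -> is_d1 (frd m 0 0 0 : MZ) m.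
Proof.
by move=> m1; have := @is_d1_reduced k m 0; rewrite scaler0; apply; lia.
Qed.

Lemma rank1_orbit x : has_rank x 1 ->
  exists m : int, [/\ 1 <= m, is_d1 x m & same_orbit x (frd m 0 0 0)].
Proof.
move=> /has_rank1[x0 _ tx rx].
have [al [A [al_gt0 A0 o]]] := reduction_rank2 x0 tx.
have A00 := rank1_vanishes_inv al_gt0 A0 (rank1_vanishes_orbit o rx).
exists al; rewrite A00 in o.
split=> //; apply: is_d1_orbit (orbit_sym o) _.
by apply: is_d1_corner.
Qed.

Lemma is_d1_mdiag (l m : int) :
  0 < l -> (l %| m)%Z -> is_d1 (mdiag k l 0 m 0 0) l.
Proof.
move=> l0 /dvdzP[q ->]; rewrite mdiag_frd.
have := is_d1_reduced (herm q 0 0 0 0 0 : JZ) l0.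
by rewrite hermZ !mulr0 !scaler0 mulrC.
Qed.

Lemma rank2_orbit x : has_rank x 2 -> exists l m : int,
  [/\ 0 < l, 0 < m & (l %| m)%Z] /\
  [/\ is_d1 x l, is_d2 x (2 * l * m) & same_orbit x (mdiag k l 0 m 0 0)].
Proof.
move=> /has_rank2[x0 _ tx rx].
have [al [A [al_gt0 A0 o]]] := reduction_rank2 x0 tx.
have An0 : al *: A != 0.
  apply/eqP => A00; apply: rx; apply: rank1_vanishes_orbit (orbit_sym o) _.
  by rewrite A00; exact: rank1_vanishes_reduced.
have sharp0 A' : same_orbit x (frd al 0 A' 0) -> jsharp A' = 0.
  by move=> /triple_vanishes_orbit /(_ tx) /(triple_vanishes_inv al_gt0)[].
have [m [m_gt0 o']] := rank_two_diag sharp0 o An0.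
have d1x : is_d1 x al.
  exact: is_d1_orbit (orbit_sym o) (is_d1_reduced _ al_gt0).
have alm : (al %| m)%Z.
  have /is_d1P[[x' ex] _] := is_d1_orbit o' d1x.
  elim/frdhP: x' ex => ga de a b c u v w b1 b2 b3 u' v' w'.
  rewrite frdZ hermZ => /frd_inj[_ _ /herm_inj[-> _ _ _] _].
  exact: dvdz_mulr.
exists al, m; rewrite mdiag_frd; split=> //; split=> //.
by apply: is_d2_orbit (orbit_sym o') (is_d2_reduced k al_gt0 m_gt0).
Qed.

(** The coprimality conditions enter the reduction only as Bezout relations.
    *)
Lemma bezout3 (a b c : int) :
  gcd3 a b c = 1 -> exists r s t, r * a + s * b + t * c = 1.
Proof.
move=> g1; have [u [v e1]] := Bezoutz a b.
have [p [q e2]] := Bezoutz (gcdz a b) c.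
exists (p * u), (p * v), q; rewrite -[RHS]g1 /gcd3 -e2 -e1.
by ring.
Qed.

Lemma projective_normal x : projective x -> exists eps m : int,
  (eps = 0 \/ eps = 1) /\ same_orbit x (mdiag k 1 eps 1 1 m).
Proof.
move=> [al [be [a [b [c [o red /and3P[/eqP g1 /eqP g2 _]]]]]]].
move: red => /and5P[al_gt0 _ ala alb alc].
have [r [s [t h1]]] := bezout3 g1; have [r' [s' [t' h2]]] := bezout3 g2.
have al1 : al = 1.
  have /dvdzP[q eb] := alb.
  have e : al * (r * a + s * be + t * (q * c)) = 1 by rewrite -[RHS]h1 eb; ring.
  have : al <= 1 by rewrite -e; apply: le_divisor; rewrite e.
  by move=> ?; apply/eqP; rewrite eq_le; apply/andP; split=> //.
rewrite al1 !mul1r in h1 h2; rewrite al1 mdiag_frd -/(dia k be a b c) in o.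
have [be' [m o']] := dia_projective h1 h2 o.
have [eps [m' [eps01 o2]]] := dia_normal o'.
by exists eps, m'; rewrite mdiag_frd.
Qed.

Lemma q'Z_orbit x y : same_orbit x y -> q'Z x = q'Z y.
Proof. by move=> [g [[_ qg _] <-]]; rewrite /q'Z qg. Qed.

Lemma q'Z_mdiag (eps m : int) :
  q'Z (mdiag k 1 eps 1 1 m) = (4 * m + eps ^+ 2)%:~R.
Proof.
rewrite /q'Z qZE mdiag_frd -/(dia k eps 1 1 m) quart_dia.
by rewrite !(rmorphD, rmorphB, rmorphN, rmorphM, rmorphXn) /=; field.
Qed.

(** Squares of 0 and 1 are distinct modulo 4. *)
Lemma normal_uniq (eps m eps' m' : int) : eps = 0 \/ eps = 1 ->
  eps' = 0 \/ eps' = 1 -> 4 * m + eps ^+ 2 = 4 * m' + eps' ^+ 2 ->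
  eps = eps' /\ m = m'.
Proof. by move=> [->|->] [->|->]; lia. Qed.

End Classification.

Theorem theorem52 (k : comp_kind) :
  let MZ := freudenthal (comp_alg k int) in
  [/\ (* rank 1 *)
      (forall x : MZ, has_rank x 1%N ->
         exists al : int, is_d1 x al /\ same_orbit x (melt al 0 0 0)) /\
      orbit_representatives
        [set x : MZ | has_rank x 1%N]%classic
        [set x : MZ | exists m : int, 1 <= m /\ x = melt m 0 0 0]%classic,
      (* rank 2 *)
      (forall x : MZ, has_rank x 2%N ->
         exists al a d2 : int,
           [/\ is_d1 x al, is_d2 x d2,
               a%:~R = d2%:~R / (2 * al%:~R) :> rat, (al %| a)%Z
             & same_orbit x (mdiag k al 0 a 0 0)]) /\
      orbit_representatives
        [set x : MZ | has_rank x 2%N]%classic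
        [set x : MZ | exists l m : int,
           [/\ 0 < l, 0 < m, (l %| m)%Z & x = mdiag k l 0 m 0 0]]%classic
    & (* rank 3 or 4 *)
      (forall (n : int) (x y : MZ),
         has_rank x 3%N \/ has_rank x 4%N -> projective x -> q'Z x = n%:~R ->
         has_rank y 3%N \/ has_rank y 4%N -> projective y -> q'Z y = n%:~R ->
         same_orbit x y) /\
      (forall x : MZ,
         has_rank x 3%N \/ has_rank x 4%N -> projective x ->
         exists eps m : int,
           [/\ eps = 0 \/ eps = 1,
               m%:~R = (q'Z x - eps%:~R ^+ 2) / 4 :> rat,
               exists j : int, q'Z x = (eps + 2 * j)%:~R,
               same_orbit x (mdiag k 1 eps 1 1 m)
             & forall eps' m' : int, eps' = 0 \/ eps' = 1 ->
                 same_orbit x (mdiag k 1 eps' 1 1 m') ->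
                 eps' = eps /\ m' = m])].
Proof.
move=> MZ; split; split.
- move=> x /rank1_orbit[m [_ d1m o]]; exists m; split=> //.
  by rewrite melt_frd.
- split.
  + move=> _ [m [m1 ->]]; rewrite melt_frd; apply: has_rank1_reduced.
    exact: lt_le_trans m1.
  + move=> x /rank1_orbit[m [m1 _ o]]; exists (frd m 0 0 0); split=> //.
    by exists m; rewrite melt_frd.
  move=> _ _ [m [m1 ->]] [m' [m1' ->]]; rewrite !melt_frd => o.
  congr frd; apply: is_gcd_uniq (is_d1_orbit o (is_d1_corner k m1)) _.
  exact: is_d1_corner.
- move=> x /rank2_orbit[l [m [[l0 m0 lm] [d1x d2x o]]]].
  exists l, m, (2 * l * m); split=> //.
  have l0' : (l%:~R : rat) != 0 by rewrite intr_eq0 gt_eqF.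
  by rewrite !rmorphM /=; field.
- split.
  + move=> _ [l [m [l0 m0 lm ->]]]; rewrite mdiag_frd.
    apply: has_rank2_reduced => //; first exact: jsharp_diag1.
    by rewrite herm0; apply/eqP => /herm_inj[m00]; rewrite m00 in m0.
  + move=> x /rank2_orbit[l [m [[l0 m0 lm] [_ _ o]]]].
    by exists (mdiag k l 0 m 0 0); split=> //; exists l, m.
  move=> _ _ [l [m [l0 m0 lm ->]]] [l' [m' [l0' m0' lm' ->]]] o.
  have ll : l = l'.
    apply: is_gcd_uniq (is_d1_orbit o (is_d1_mdiag k l0 lm)) _.
    exact: is_d1_mdiag.
  rewrite -ll; congr mdiag.
  have d2 := is_d2_reduced k l0 m0; have d2' := is_d2_reduced k l0' m0'.
  rewrite -!mdiag_frd in d2 d2'.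
  have := is_gcd_uniq (is_d2_orbit o d2) d2'; rewrite -ll => /mulfI; apply.
  by rewrite mulf_neq0 // gt_eqF.
- move=> n x y _ /projective_normal[eps [m [e01 o]]] qx _.
  move=> /projective_normal[eps' [m' [e01' o']]] qy.
  have [ee mm] : eps = eps' /\ m = m'.
    apply: normal_uniq => //; apply: (@intr_inj rat).
    by rewrite -!(q'Z_mdiag k) -(q'Z_orbit o) -(q'Z_orbit o') qx qy.
  by apply: orbit_trans o _; rewrite ee mm; exact: orbit_sym.
move=> x _ /projective_normal[eps [m [e01 o]]]; exists eps, m.
have qx := q'Z_orbit o; rewrite q'Z_mdiag in qx; split=> //.
- by rewrite qx !(rmorphD, rmorphM, rmorphXn) /=; field.
- exists (2 * m); rewrite qx; congr (_%:~R).
  by case: e01 => ->; ring.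
move=> eps' m' e01' o'; apply: normal_uniq => //; apply: (@intr_inj rat).
by rewrite -!(q'Z_mdiag k) -(q'Z_orbit o) -(q'Z_orbit o').
Qed.
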